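(* Let $C_0=24e^2$. For every partial sign matrix $A\in\{-1,1,*\}^{M\times N}$, $$\operatorname{ind}|S(A)|\leq C_0\log(2N)\log(2M).$$ In particular, $\operatorname{ind}|S(A)|\leq C_0\log^2(2N)$ for a square matrix ($M=N$).
   Context: All logarithms are natural, $\log^2(x)=(\log x)^2$, and $M,N\geq1$. Let $A\in\{-1,1,*\}^{M\times N}$ be a partial sign matrix with columns indexed by $[N]=\{1,\dots,N\}$. Its sign complex $S(A)$ is the simplicial complex generated by the following simplices on the signed column set $\{1^+,1^-,\dots,N^+,N^-\}$: $$\sigma_r^+=\{i^+:r_i=+1\}\cup\{i^-:r_i=-1\},\qquad \sigma_r^-=-\sigma_r^+,$$ as $r$ ranges over the rows of $A$, where $-$ exchanges $i^+$ and $i^-$ for every $i$. (Columns consisting entirely of $*$ entries contribute no vertices.) Exchanging $i^+$ and $i^-$ defines a free simplicial involution on $S(A)$, and $|S(A)|$ denotes the geometric realization with the induced free involution. A continuous map between spaces with free (fixed-point-free) involutions is equivariant if it commutes with the involutions; spheres carry the antipodal involution. For a space $X$ with a free involution, $\operatorname{ind}X=\min\{k\geq0:\text{there is an equivariant map }X\to S^k\}$, with value $+\infty$ if no such map exists, and $\operatorname{ind}\varnothing=-1$. *)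

(* Defs.v *)
From mathcomp Require Import all_boot all_order all_algebra.
From mathcomp Require Import all_classical all_reals all_analysis.
From mathcomp Require Import lra.

Set Implicit Arguments.
Unset Strict Implicit.
Unset Printing Implicit Defensive.

Import Order.TTheory GRing.Theory Num.Theory.
Import numFieldNormedType.Exports.

Local Open Scope classical_set_scope.
Local Open Scope ring_scope.

Definition is_free_involution (T : topologicalType) (X : set T)
    (nu : T -> T) : Prop :=
  [/\ {within X, continuous nu},
      forall x, X x -> X (nu x),
      forall x, X x -> nu (nu x) = x &
      forall x, X x -> nu x <> x].

(* A space is represented as a subset of an ambient space, with the subspace
   topology. Maps are total functions between ambient spaces, but only their
   values on the subset matter; every map on the subset extends to such a
   function when the ambient target is inhabited, as it is for spheres. *)
Record free_z2space := FreeZ2Space {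
  ambient : topologicalType;
  points : set ambient;
  invol : ambient -> ambient;
  involP : is_free_involution points invol
}.

Arguments points : clear implicits.
Arguments invol : clear implicits.

Definition equivariant_map (X Y : free_z2space)
    (f : ambient X -> ambient Y) : Prop :=
  [/\ {within points X, continuous f},
      forall x, points X x -> points Y (f x) &
      forall x, points X x -> f (invol X x) = invol Y (f x)].

Section Sphere.
Variables (R : realType) (k : nat).

Definition sphere_set : set 'rV[R]_k.+1 :=
  [set y | \sum_(i < k.+1) y ord0 i ^+ 2 = 1].

Lemma sphere_antipode :
  is_free_involution sphere_set (fun y : 'rV[R]_k.+1 => - y).
Proof.
split.
- by apply: continuous_subspaceT => x; exact: opp_continuous.
- by move=> y yS; rewrite /sphere_set /= -[RHS]yS; apply: eq_bigr => i _;
    rewrite mxE sqrrN.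
- by move=> y _; rewrite opprK.
- move=> y yS ny; have y0 i : y ord0 i = 0.
    by move/rowP/(_ i): ny; rewrite mxE; lra.
  move: yS; rewrite /sphere_set /= big1 => [/eqP|i _].
    by rewrite eq_sym oner_eq0.
  by rewrite y0 expr0n.
Qed.

Definition sphere : free_z2space := FreeZ2Space sphere_antipode.
End Sphere.

Section Index.
Variables (R : realType) (X : free_z2space).

Definition maps_to_sphere : pred nat :=
  fun k => `[< exists f, @equivariant_map X (sphere R k) f >].

Definition ind : \bar R :=
  if pselect (points X = set0) then (-1)%:E else
  match pselect (exists k, maps_to_sphere k) with
  | left e => (ex_minn e)%:R%:E
  | right _ => +oo%E
  end.
End Index.

(* Barycentric coordinates; K is the set of all simplices of the complex,
   possibly including the empty one, which contributes no point. *)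
Definition realization (R : realType) (V : finType) (K : {set {set V}}) :
    set {ptws V -> R} :=
  [set x | [/\ forall v, 0 <= x v, \sum_v x v = 1 &
               [set v | x v != 0]%SET \in K]].

Arguments realization R {V} K.

Lemma reindex_continuous (T : topologicalType) (V : eqType) (g : V -> V) :
  continuous (fun x : {ptws V -> T} => (x \o g : {ptws V -> T})).
Proof.
move=> x; have Fx : Filter (nbhs x) by exact: nbhs_filter.
apply: (iffRL (@cvg_sup _ _ _ _ _ _)).
move=> v; move: x {Fx}; apply/(@continuousP _ (initial_topology (@^~ v))) => A [B oB <-].
rewrite (_ : _ @^-1` _ = (@proj V (fun=> T) (g v)) @^-1` B)//.
apply: open_comp => // x _; exact: proj_continuous.
Qed.

(* [Some true] is +1, [Some false] is -1 and [None] is the unspecified entry. *)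
Definition partial_sign_matrix (M N : nat) := 'M[option bool]_(M, N).

(* (i, true) stands for i^+ and (i, false) for i^-. *)
Definition signed_column (N : nat) : finType := ('I_N * bool)%type.

Definition flip (N : nat) (v : signed_column N) : signed_column N :=
  (v.1, ~~ v.2).

Lemma flipK (N : nat) : involutive (@flip N).
Proof. by case=> i b; rewrite /flip /= negbK. Qed.

Section SignComplex.
Variables (M N : nat) (A : partial_sign_matrix M N).

Definition sigma_pos (r : 'I_M) : {set signed_column N} :=
  [set v | A r v.1 == Some v.2]%SET.

Definition sigma_neg (r : 'I_M) : {set signed_column N} :=
  (@flip N @: sigma_pos r)%SET.

Definition sign_complex : {set {set signed_column N}} :=
  [set s : {set signed_column N} |
    [exists r, (s \subset sigma_pos r) || (s \subset sigma_neg r)]]%SET.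

Lemma sigma_negE r v : (v \in sigma_neg r) = (flip v \in sigma_pos r).
Proof.
by rewrite -{1}(flipK v) mem_imset//; exact: inv_inj (@flipK N).
Qed.

Lemma sign_complex_flip s :
  s \in sign_complex -> (@flip N @^-1: s)%SET \in sign_complex.
Proof.
rewrite !inE => /existsP[r sr]; apply/existsP; exists r.
rewrite orbC; case/orP: sr => /fintype.subsetP sr; apply/orP; [left|right];
  apply/fintype.subsetP => v; rewrite inE => /sr.
- by rewrite sigma_negE.
- by rewrite sigma_negE flipK.
Qed.

Lemma sign_complex_free s v :
  s \in sign_complex -> v \in s -> flip v \notin s.
Proof.
rewrite inE => /existsP[r /orP[] /fintype.subsetP sr] /sr vr;
  apply/negP => /sr; move: vr; rewrite ?sigma_negE ?flipK !inE /=.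
- by move=> /eqP->; case: v.2.
- by move=> /eqP->; case: v.2.
Qed.

Variable R : realType.

Definition swap_coords (x : {ptws signed_column N -> R}) :
  {ptws signed_column N -> R} := x \o @flip N.

Lemma swap_coords_free :
  is_free_involution (realization R sign_complex) swap_coords.
Proof.
split.
- apply: continuous_subspaceT.
  exact: (@reindex_continuous R (signed_column N) (@flip N)).
- move=> x [x0 x1 xK]; split=> [v||]; first exact: x0.
  + by rewrite -[RHS]x1 [RHS](reindex_inj (inv_inj (@flipK N))).
  + suff -> : [set v | swap_coords x v != 0]%SET
      = (@flip N @^-1: [set v | x v != 0])%SET by exact: sign_complex_flip.
    by apply/setP => v; rewrite !inE.
- by move=> x _; apply/funext => v; rewrite /swap_coords /= flipK.
- move=> x [x0 x1 xK] fx.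
  suff xz v : x v = 0.
    by move: x1; rewrite big1// => /eqP; rewrite eq_sym oner_eq0.
  apply/eqP/negPn/negP => xv.
  have := @sign_complex_free _ v xK; rewrite !inE xv => /(_ isT).
  by rewrite -[x (flip v)]/(swap_coords x v) fx xv.
Qed.

Definition realized_sign_complex : free_z2space := FreeZ2Space swap_coords_free.
End SignComplex.

(* Main.v *)
Require Import Defs.
From mathcomp Require Import all_boot all_order all_algebra.
From mathcomp Require Import all_classical all_reals all_analysis.
From mathcomp Require Import ring lra zify.

(** Why the theorem is true.

    A point x of the complex gives a vector y with y_j = x(j^+) - x(j^-) and
    the vector z = A y, where unspecified entries count as 0; both are odd
    in x. Since the support of x lies in some sigma_r^+ or sigma_r^-, the
    l^1 norm of y is at most 1 while some |z_i| equals 1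
    (row_values_normalized). It suffices to find an odd continuous map to
    R^d, with d - 1 at most the claimed bound, which has no zero on the
    vectors z of this kind.

    Give R^M the l^(2k+2) norm and R^N the l^(2l+2) norm, k and l being the
    integer parts of log M and log N; they agree with the sup norms up to a
    factor e. The polynomial map step sends u to A u^(2k+1) (coordinatewise
    power), that is, it applies the duality map of l^(2k+2) and then the
    matrix; a round trip is a step with the transpose of A and a step back.
    By Hoelder's inequality the iterated round trip does not shrink the
    vectors coming from the complex (nondecaying_start, nondecaying_step).

    The round trip contracts volumes, at every point. Measure small
    displacements at v by the Hessian of the norm there (local_form). In
    these metrics the derivative of a step has squared Hilbert-Schmidt norm
    at most t = (2k+1)(2l+1)e^2, since the coordinate weights of both
    Hessians have bounded total mass (sum_lower_power, sum_sqr_direction).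
    So d-dimensional volume is contracted as soon as d is a large enough
    multiple of t. Iterating, the image of all vectors z has arbitrarily
    small d-dimensional content, and a linear map to R^d picked at random
    has no zero on it. The map to the sphere is this linear map after
    sufficiently many round trips, normalized.

    The content is bounded by an averaging argument. The image of a patch of
    radius r is nearly an ellipsoid. Put a random centre in it, built from
    independent signs; a given point of the image lies within e^(-1/2) r of
    the centre with probability at least p = cover_prob (many_close_signs).
    Call a linear map bad for a patch when it vanishes at the final image of
    one of its points. By double counting (fractional_cover), the fraction of
    maps which are bad for a given patch of radius r is at most 1/p times the
    worst fraction for patches of radius e^(-1/2) r, one step later
    (half_step). When no step is left, that fraction is of order r^d
    (base_count). Hence m steps
    give a bound of order (e^(-d/2) / p)^m, which is eventually below the
    inverse of the number of patches needed at the start (grid_cover,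
    nonvanishing_functionals). The condition e^(-d/2) < p amounts to
    d > 6t + 2 log 2601; it holds when d > 24 e^2 log(2N) log(2M), because
    t falls short of 4 e^2 log(2N) log(2M) by a definite amount
    (contraction_lt_cover_prob). *)

Set Implicit Arguments.
Unset Strict Implicit.
Unset Printing Implicit Defensive.

Import Order.TTheory GRing.Theory Num.Theory.
Import numFieldNormedType.Exports.

Local Open Scope ring_scope.

(** * Powers *)

Section Powers.
Variable R : realFieldType.
Implicit Types (a b x y B : R) (n k : nat).

(** Convexity of the power. In the induction, multiplying the case n by b
    leaves a defect which is a nonnegative multiple of (b - a)^2. *)
Lemma tangent_nonneg a b n : 0 <= a -> 0 <= b ->
  a ^+ n.+1 + n.+1%:R * a ^+ n * (b - a) <= b ^+ n.+1.
Proof.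
move=> a0 b0; elim: n => [|n IHn]; first by rewrite !expr1 expr0; lra.
have {IHn} := ler_wpM2l b0 IHn; rewrite -exprS; apply: le_trans.
rewrite -subr_ge0.
suff -> : b * (a ^+ n.+1 + n.+1%:R * a ^+ n * (b - a)) -
    (a ^+ n.+2 + n.+2%:R * a ^+ n.+1 * (b - a)) =
    n.+1%:R * a ^+ n * (b - a) ^+ 2.
  by rewrite mulr_ge0 ?sqr_ge0// mulr_ge0 ?exprn_ge0.
by rewrite -[in n.+2%:R]natr1 !exprS; ring.
Qed.

Lemma tangent_even a b k :
  a ^+ k.*2.+2 + k.*2.+2%:R * a ^+ k.*2.+1 * (b - a) <= b ^+ k.*2.+2.
Proof.
have ev x : `|x| ^+ k.*2.+2 = x ^+ k.*2.+2.
  by rewrite -normrX ger0_norm// exprn_even_ge0// /= odd_double.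
rewrite -(ev b); apply: le_trans _ (tangent_nonneg _ (normr_ge0 a) (normr_ge0 b)).
rewrite -(ev a) lerD2l -!mulrA ler_wpM2l// !mulrBr -!exprSr ev lerD2r.
by rewrite -normrX -normrM ler_norm.
Qed.

Lemma lipschitz_pow B x y n : 1 <= B -> `|x| <= B -> `|y| <= B ->
  `|x ^+ n - y ^+ n| <= n%:R * B ^+ n * `|x - y|.
Proof.
move=> B1 xB yB; have B0 : 0 <= B by lra.
elim: n => [|n IHn]; first by rewrite subrr normr0 !mul0r.
have -> : x ^+ n.+1 - y ^+ n.+1 = x * (x ^+ n - y ^+ n) + y ^+ n * (x - y).
  by rewrite !exprS; ring.
rewrite (le_trans (ler_normD _ _))// !normrM normrX.
have -> : n.+1%:R * B ^+ n.+1 * `|x - y| =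
    B * (n%:R * B ^+ n * `|x - y|) + B ^+ n.+1 * `|x - y|.
  by rewrite -natr1 exprS; ring.
apply: lerD; first exact: ler_pM.
rewrite ler_wpM2r//.
apply: le_trans (_ : B ^+ n <= _); first by rewrite lerXn2r ?nnegrE.
by rewrite ler_weXn2l.
Qed.

Lemma pow_taylor1 B x y n : 1 <= B -> `|x| <= B -> `|y| <= B ->
  `|x ^+ n.+1 - y ^+ n.+1 - n.+1%:R * y ^+ n * (x - y)| <=
    n.+1%:R ^+ 2 * B ^+ n.+1 * (x - y) ^+ 2.
Proof.
move=> B1 xB yB; have B0 : 0 <= B by lra.
elim: n => [|n IHn].
  rewrite !expr1 expr0; have -> : x - y - 1 * 1 * (x - y) = 0 by ring.
  by rewrite normr0 mulr_ge0 ?sqr_ge0// mulr_ge0// ?sqr_ge0.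
have -> : x ^+ n.+2 - y ^+ n.+2 - n.+2%:R * y ^+ n.+1 * (x - y) =
   x * (x ^+ n.+1 - y ^+ n.+1 - n.+1%:R * y ^+ n * (x - y)) +
   n.+1%:R * y ^+ n * (x - y) ^+ 2.
  by rewrite -[in n.+2%:R]natr1 !exprS; ring.
rewrite (le_trans (ler_normD _ _))// normrM.
have yn : `|n.+1%:R * y ^+ n * (x - y) ^+ 2| <=
    n.+1%:R * B ^+ n.+2 * (x - y) ^+ 2.
  rewrite normrM (ger0_norm (sqr_ge0 _)) normrM normr_nat normrX.
  rewrite ler_wpM2r ?sqr_ge0// ler_wpM2l//.
  apply: le_trans (_ : B ^+ n <= _); first by rewrite lerXn2r ?nnegrE.
  by rewrite ler_weXn2l// -addn2 leq_addr.
apply: le_trans (lerD (ler_pM _ _ xB IHn) yn) _ => //.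
have -> : B * (n.+1%:R ^+ 2 * B ^+ n.+1 * (x - y) ^+ 2) +
  n.+1%:R * B ^+ n.+2 * (x - y) ^+ 2 =
  (n.+1%:R ^+ 2 + n.+1%:R) * B ^+ n.+2 * (x - y) ^+ 2.
  by rewrite !exprS; ring.
rewrite ler_wpM2r ?sqr_ge0// ler_wpM2r ?exprn_ge0// -[in n.+2%:R]natr1.
have : 0 <= n.+1%:R :> R by []; nra.
Qed.

End Powers.

(** * Biased signs *)

Section Sampling.
Variables (R : realType) (S J : finType).

Definition sign_of (b : bool) : R := if b then 1 else -1.

Lemma sum_prod_ffun (F : S -> bool -> R) :
  \sum_(s : {ffun S -> bool}) \prod_i F i (s i) = \prod_i (F i true + F i false).
Proof.
by rewrite -bigA_distr_bigA; apply: eq_bigr => i _; rewrite big_bool.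
Qed.

Variables (th : S -> R).
Hypothesis th1 : forall i, `|th i| <= 1.

(** The law of independent signs with means th i. *)
Definition biased_prob (s : {ffun S -> bool}) : R :=
  \prod_i ((1 + th i * sign_of (s i)) / 2).

Lemma biased_ge0 s : 0 <= biased_prob s.
Proof.
apply: prodr_ge0 => i _; have := th1 i; rewrite ler_norml => /andP[? ?].
by rewrite divr_ge0// /sign_of; case: (s i); lra.
Qed.

Lemma sum_biased_prob : \sum_s biased_prob s = 1.
Proof.
rewrite (sum_prod_ffun (fun i b => (1 + th i * sign_of b) / 2)) big1// => i _.
by rewrite /sign_of; field.
Qed.

Lemma sum_sqr_biased_prob :
  \sum_s biased_prob s ^+ 2 <= expR (\sum_i th i ^+ 2) / (2 ^ #|S|)%:R.
Proof.
have -> : \sum_s biased_prob s ^+ 2 = \prod_i ((1 + th i ^+ 2) / 2).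
  transitivity (\sum_(s : {ffun S -> bool})
      \prod_i ((1 + th i * sign_of (s i)) / 2) ^+ 2).
    by apply: eq_bigr => s _; rewrite /biased_prob prodrXl.
  rewrite (sum_prod_ffun (fun i b => ((1 + th i * sign_of b) / 2) ^+ 2)).
  by apply: eq_bigr => i _; rewrite /sign_of; field.
rewrite big_split/= prodr_const natrX exprVn ler_pM2r ?invr_gt0 ?exprn_gt0//.
rewrite expR_sum ler_prod// => i _; rewrite expR_ge1Dx andbT.
by rewrite addr_ge0 ?sqr_ge0.
Qed.

Lemma biased_covariance i j :
  \sum_s biased_prob s * ((th i - sign_of (s i)) * (th j - sign_of (s j))) =
    if i == j then 1 - th i ^+ 2 else 0.
Proof.
(* The product over all signs factors; for i <> j the factor at i is 0. *)
pose F u b : R := (1 + th u * sign_of b) / 2 *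
   ((if u == i then th i - sign_of b else 1) *
    (if u == j then th j - sign_of b else 1)).
have -> : \sum_s biased_prob s * ((th i - sign_of (s i)) * (th j - sign_of (s j))) =
   \sum_(s : {ffun S -> bool}) \prod_u F u (s u).
  apply: eq_bigr => s _; rewrite /F !big_split/= -/(biased_prob s).
  by rewrite -!big_mkcond/= !big_pred1_eq /biased_prob big_split.
rewrite sum_prod_ffun; have [ij|ij] := eqVneq i j.
  rewrite (bigD1 i)//= big1 ?mulr1 => [|u ui].
    by rewrite /F -ij !eqxx /sign_of; field.
  by rewrite /F -ij (negbTE ui) /sign_of; field.
by rewrite (bigD1 i)//= /F !eqxx (negbTE ij) /sign_of; ring.
Qed.

Variables (b : S -> J -> R) (W : J -> R).
Hypothesis W0 : forall r, 0 <= W r.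

Definition deviation (s : {ffun S -> bool}) : R :=
  \sum_r W r * (\sum_i b i r * (th i - sign_of (s i))) ^+ 2.

Lemma mean_deviation :
  \sum_s biased_prob s * deviation s <= \sum_i \sum_r W r * b i r ^+ 2.
Proof.
have -> : \sum_s biased_prob s * deviation s =
   \sum_r W r * \sum_i \sum_j b i r * b j r *
     (\sum_s biased_prob s * ((th i - sign_of (s i)) * (th j - sign_of (s j)))).
  under eq_bigr do rewrite mulr_sumr.
  rewrite exchange_big/=; apply: eq_bigr => r _.
  rewrite mulr_sumr; under [RHS]eq_bigr do rewrite mulr_sumr.
  transitivity (\sum_s \sum_i \sum_j biased_prob s * (W r * (b i r * b j r *
     ((th i - sign_of (s i)) * (th j - sign_of (s j)))))).
    apply: eq_bigr => s _.
    rewrite expr2 mulr_suml mulr_sumr mulr_sumr; apply: eq_bigr => i _.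
    rewrite mulr_sumr mulr_sumr mulr_sumr; apply: eq_bigr => j _; ring.
  rewrite exchange_big/=; apply: eq_bigr => i _.
  rewrite exchange_big/=; apply: eq_bigr => j _.
  rewrite !mulr_sumr; apply: eq_bigr => s _; ring.
rewrite [leRHS]exchange_big/=; apply: ler_sum => r _.
rewrite -mulr_sumr ler_wpM2l//; apply: ler_sum => i _.
under eq_bigr do rewrite biased_covariance.
rewrite (bigD1 i)//= big1 ?addr0 ?eqxx => [|j]; last first.
  by rewrite eq_sym => /negbTE->; rewrite mulr0.
by have := sqr_ge0 (b i r); have := sqr_ge0 (th i); nra.
Qed.

(** Change of measure. Under the biased law the deviation has mean at most
    tau, so by Markov's inequality the event below has biased probability at
    least 1 - tau / q. The density of the biased law has second moment at most
    e^X, and Cauchy-Schwarz carries the bound over to uniform signs. Neither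
    the number of signs nor the number of coordinates enters. *)
Lemma many_close_signs (X q tau : R) : 0 < q ->
  \sum_i th i ^+ 2 <= X ->
  \sum_i \sum_r W r * b i r ^+ 2 <= tau -> tau <= q ->
  (1 - tau / q) ^+ 2 * expR (- X) * (2 ^ #|S|)%:R <=
    #|[set s | deviation s <= q]|%:R.
Proof.
move=> q0 thX btau tauq; set K := [set s | _]; set Z : R := (2 ^ #|S|)%:R.
have Z0 : 0 < Z by rewrite ltr0n expn_gt0.
have nuK : 1 - tau / q <= \sum_(s in K) biased_prob s.
  rewrite -sum_biased_prob (bigID (mem K))/= lerBlDr lerD2l ler_pdivlMr//.
  apply: le_trans btau; apply: le_trans mean_deviation.
  rewrite mulr_suml [leRHS](bigID (mem K))/= -[leLHS]add0r; apply: lerD.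
    apply: sumr_ge0 => s _; rewrite mulr_ge0 ?biased_ge0//.
    by apply: sumr_ge0 => r _; rewrite mulr_ge0 ?sqr_ge0.
  apply: ler_sum => s; rewrite inE -ltNge => /ltW qs.
  by rewrite ler_wpM2l ?biased_ge0.
have sq : (\sum_(s in K) biased_prob s) ^+ 2 <= #|K|%:R * (expR X / Z).
  set T := \sum_(s in K) biased_prob s.
  have : \sum_(s in K) biased_prob s ^+ 2 <= expR X / Z.
    apply: le_trans (_ : expR (\sum_i th i ^+ 2) / Z <= _).
      apply: le_trans sum_sqr_biased_prob.
      rewrite [leRHS](bigID (mem K))/= lerDl; apply: sumr_ge0 => s _.
      exact: sqr_ge0.
    by rewrite ler_pM2r ?invr_gt0// ler_expR.
  move: (_ / Z) => E hE.
  have : 0 <= \sum_(s in K) (#|K|%:R * biased_prob s - T) ^+ 2.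
    by apply: sumr_ge0 => s _; exact: sqr_ge0.
  have -> : \sum_(s in K) (#|K|%:R * biased_prob s - T) ^+ 2 =
     #|K|%:R * (#|K|%:R * (\sum_(s in K) biased_prob s ^+ 2) - T ^+ 2).
    rewrite (eq_bigr (fun s => #|K|%:R ^+ 2 * biased_prob s ^+ 2
       + (- 2 * #|K|%:R * T) * biased_prob s + T ^+ 2)); last by move=> s _; ring.
    rewrite big_split/= big_split/= -!mulr_sumr sumr_const -/T -mulr_natl; ring.
  have [K0|K0] := posnP #|K|.
    by move=> _; rewrite K0 mul0r /T (cards0_eq K0) big_set0 expr0n.
  rewrite pmulr_rge0 ?ltr0n// subr_ge0 => /le_trans; apply.
  by rewrite ler_wpM2l.
have [neg|pos] := lerP (tau / q) 1; last first.
  by move: pos; rewrite ltr_pdivlMr// mul1r ltNge tauq.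
have : (1 - tau / q) ^+ 2 <= #|K|%:R * (expR X / Z).
  apply: le_trans sq; rewrite lerXn2r ?nnegrE ?subr_ge0//.
  by apply: le_trans nuK; rewrite subr_ge0.
rewrite mulrA ler_pdivlMr// => h.
by rewrite expRN mulrAC ler_pdivrMr ?expR_gt0.
Qed.

End Sampling.

(** * Orbits *)

Section Orbits.
Variable R : realType.
Implicit Types (I J : finType) (k l : nat).

(** A power of the l^(2k+2) norm. Even exponents and the absence of roots
    keep all maps and conditions polynomial. *)
Definition moment I k (u : I -> R) : R := \sum_i u i ^+ k.*2.+2.

(** The duality map of l^(2k+2), up to a positive factor, followed by the
    matrix. *)
Definition step I J (A : J -> I -> R) k (u : I -> R) : J -> R :=
  fun r => \sum_i A r i * u i ^+ k.*2.+1.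

(** The norm of step A k u is at least the (2k+1)-st power of the norm of
    u, raised to the power (2k+2)(l+1) to avoid roots. *)
Definition nondecaying I J (A : J -> I -> R) k l (u : I -> R) : Prop :=
  moment k u ^+ (k.*2.+1 * l.+1) <= moment l (step A k u) ^+ k.+1.

Lemma pow_even_ge0 k (x : R) : 0 <= x ^+ k.*2.
Proof. by rewrite exprn_even_ge0// odd_double. Qed.

Lemma moment_ge0 I k (u : I -> R) : 0 <= moment k u.
Proof. by apply: sumr_ge0 => i _; rewrite -doubleS pow_even_ge0. Qed.

Lemma le_moment I k (u : I -> R) i : u i ^+ k.*2.+2 <= moment k u.
Proof.
rewrite /moment (bigD1 i)//= lerDl sumr_ge0// => j _.
by rewrite -doubleS pow_even_ge0.
Qed.

Lemma moment_eq0 I k (u : I -> R) i : moment k u = 0 -> u i = 0.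
Proof.
move=> u0; have := le_moment k u i; rewrite u0 => ui.
have : u i ^+ k.*2.+2 == 0 by rewrite eq_le ui -doubleS pow_even_ge0.
by rewrite expf_eq0 /= => /eqP.
Qed.

(** Hoelder's inequality for w and u^(2k+1). Sum the tangent inequality at
    c u, where c makes the linear terms cancel. *)
Lemma holder_powers I k (w u : I -> R) :
  (\sum_i w i * u i ^+ k.*2.+1) ^+ k.*2.+2 <= moment k w * moment k u ^+ k.*2.+1.
Proof.
set V := \sum_i _; have [U0|U0] := eqVneq (moment k u) 0.
  rewrite /V big1 => [|i _]; last by rewrite (moment_eq0 i U0) expr0n/= mulr0.
  by rewrite U0 !expr0n/= mulr0.
have Up : 0 < moment k u by rewrite lt_neqAle eq_sym U0 moment_ge0.
set U := moment k u in U0 Up *; pose c := V / U.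
have : \sum_i ((c * u i) ^+ k.*2.+2 +
  k.*2.+2%:R * (c * u i) ^+ k.*2.+1 * (w i - c * u i)) <= moment k w.
  by apply: ler_sum => i _; exact: tangent_even.
have -> : \sum_i ((c * u i) ^+ k.*2.+2 +
  k.*2.+2%:R * (c * u i) ^+ k.*2.+1 * (w i - c * u i)) = c ^+ k.*2.+2 * U.
  rewrite (eq_bigr (fun i => (c ^+ k.*2.+2 - k.*2.+2%:R * c ^+ k.*2.+2) *
     u i ^+ k.*2.+2 + (k.*2.+2%:R * c ^+ k.*2.+1) * (w i * u i ^+ k.*2.+1))).
    rewrite big_split/= -!mulr_sumr -/V -[\sum_i _]/(moment k u) -/U.
    have -> : V = c * U by rewrite /c divfK.
    by rewrite !exprS; ring.
  move=> i _; clearbody c; rewrite !exprMn; move: (k.*2) => n.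
  by rewrite -[n.+2%:R]natr1 -natr1 !exprS; ring.
rewrite /c expr_div_n mulrAC ler_pdivrMr ?exprn_gt0//.
by rewrite [_ ^+ k.*2.+2 in leRHS]exprSr mulrA ler_pM2r.
Qed.

Lemma step_adjoint I J (A : J -> I -> R) k l (u : I -> R) :
  \sum_i step (fun i r => A r i) l (step A k u) i * u i ^+ k.*2.+1 =
  moment l (step A k u).
Proof.
rewrite /moment; under [RHS]eq_bigr do rewrite exprS mulrC {2}/step mulr_sumr.
rewrite exchange_big/=; apply: eq_bigr => i _.
rewrite /step mulr_suml; apply: eq_bigr => r _; ring.
Qed.

(** Pairing the second step with u^(2k+1) gives the moment of the first one
    (step_adjoint), so Hoelder's inequality turns a lower bound for the first
    step into one for the second. *)
Lemma nondecaying_step I J (A : J -> I -> R) k l (u : I -> R) :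
  nondecaying A k l u -> nondecaying (fun i r => A r i) l k (step A k u).
Proof.
rewrite /nondecaying; set z := step A k u; set w := step _ l z => gu.
have := holder_powers k w u; rewrite step_adjoint -/z.
have := moment_ge0 l z; have := moment_ge0 k u; have := moment_ge0 k w.
move: (moment l z) (moment k u) (moment k w) gu => P U N gu N0 U0 P0 hold.
have [->|Pn0] := eqVneq P 0; first by rewrite expr0n/= exprn_ge0.
have Pp : 0 < P by rewrite lt_neqAle eq_sym Pn0.
rewrite -(ler_pM2r (exprn_gt0 k.+1 Pp)).
apply: le_trans (_ : (N * U ^+ k.*2.+1) ^+ l.+1 <= _); last first.
  by rewrite exprMn -exprM ler_wpM2l ?exprn_ge0.
apply: le_trans (_ : (P ^+ k.*2.+2) ^+ l.+1 <= _); last first.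
  by rewrite lerXn2r// nnegrE ?exprn_ge0 ?mulr_ge0 ?exprn_ge0.
rewrite -exprM -exprD le_eqVlt; apply/orP; left; apply/eqP; congr (_ ^+ _).
by rewrite -doubleS -!muln2; ring.
Qed.

Lemma moment_scale I k (c : R) (u : I -> R) :
  moment k (fun i => c * u i) = c ^+ k.*2.+2 * moment k u.
Proof. by rewrite /moment mulr_sumr; apply: eq_bigr => i _; rewrite exprMn. Qed.

Lemma step_scale I J (A : J -> I -> R) k (c : R) (u : I -> R) :
  step A k (fun i => c * u i) = (fun r => c ^+ k.*2.+1 * step A k u r).
Proof.
apply/funext => r; rewrite /step mulr_sumr; apply: eq_bigr => i _.
by rewrite exprMn mulrCA.
Qed.

Lemma nondecaying_scale I J (A : J -> I -> R) k l (c : R) (u : I -> R) :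
  0 < c -> nondecaying A k l u -> nondecaying A k l (fun i => c * u i).
Proof.
move=> c0; rewrite /nondecaying step_scale !moment_scale => gu.
rewrite [leLHS]exprMn [leRHS]exprMn.
have -> : ((c ^+ k.*2.+1) ^+ l.*2.+2) ^+ k.+1 =
    (c ^+ k.*2.+2) ^+ (k.*2.+1 * l.+1).
  rewrite -(exprM c) -(exprM c) -(exprM c) -!doubleS -!muln2.
  by congr (_ ^+ _); lia.
by rewrite ler_pM2l// !exprn_gt0.
Qed.

(** Here l^1 duality replaces Hoelder's inequality: pairing the step of z
    with y gives the moment of z, so some coordinate of the step is at least
    that large. *)
Lemma nondecaying_start I J (A : J -> I -> R) k l (y : J -> R) :
  \sum_j `|y j| <= 1 -> (exists i, `|\sum_j A j i * y j| = 1) ->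
  let z i := \sum_j A j i * y j in nondecaying A k l z /\ 1 <= moment k z.
Proof.
move=> y1 [i0 zi0] z.
have P1 : 1 <= moment k z.
  apply: le_trans (le_moment k z i0); rewrite -[leLHS](expr1n _ k.*2.+2) -zi0.
  by rewrite -normrX ger0_norm// -doubleS pow_even_ge0.
split => //; rewrite /nondecaying; set w := step A k z.
have dual : \sum_j w j * y j = moment k z.
  rewrite /moment; under [RHS]eq_bigr do rewrite exprS {1}/z mulr_suml.
  rewrite exchange_big/=; apply: eq_bigr => j _.
  rewrite /w /step mulr_suml; apply: eq_bigr => i _; ring.
(* Otherwise the pairing with y would be smaller than the moment. *)
have [j wj] : exists j, moment k z <= `|w j|.
  apply: contrapT => no; suff : moment k z < moment k z by rewrite ltxx.
  have lt_w j : `|w j| < moment k z.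
    by rewrite ltNge; apply/negP => ?; apply: no; exists j.
  rewrite -{1}dual; apply: le_lt_trans (_ : \sum_j `|w j| * `|y j| < _).
    by apply: ler_sum => j _; rewrite -normrM ler_norm.
  have [y0|[j yj]] : (forall j, y j = 0) \/ exists j, y j != 0.
    have [h|/existsNP [j /eqP ?]] := pselect (forall j, y j = 0); first by left.
    by right; exists j.
  - by rewrite big1 ?(lt_le_trans _ P1)// => j _; rewrite y0 normr0 mulr0.
  - apply: lt_le_trans (_ : \sum_j moment k z * `|y j| <= _).
      rewrite (bigD1 j)//= [ltRHS](bigD1 j)//=; apply: ltr_leD.
        by rewrite ltr_pM2r ?normr_gt0.
      by apply: ler_sum => j' _; rewrite ler_wpM2r// ltW.
    by rewrite -mulr_sumr ler_piMr// (le_trans _ P1).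
have wP : moment k z ^+ l.*2.+2 <= moment l w.
  apply: le_trans (le_moment l w j).
  have <- : `|w j| ^+ l.*2.+2 = w j ^+ l.*2.+2.
    by rewrite -normrX ger0_norm// -doubleS pow_even_ge0.
  by rewrite lerXn2r ?nnegrE// moment_ge0.
apply: le_trans (_ : (moment k z ^+ l.*2.+2) ^+ k.+1 <= _); last first.
  by rewrite lerXn2r ?nnegrE ?exprn_ge0 ?moment_ge0.
rewrite -exprM ler_weXn2l//; nia.
Qed.

End Orbits.

(** * Local geometry *)

Section Local.
Variable R : realType.
Implicit Types (I J Om Si : finType) (k l : nat) (eps : R).

Lemma expR1_le : expR 1 <= 282 / 100 :> R.
Proof.
have sq_ge (c d x : R) : 0 <= c -> d <= c * c -> c <= x -> d <= x ^+ 2.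
  by move=> c0 dc cx; nra.
have x1 : 15 / 16 <= expR (- (16%:R)^-1) :> R.
  by apply: le_trans (expR_ge1Dx _); lra.
have {}x1 := sq_ge (15 / 16) (29 / 33) _ ltac:(lra) ltac:(lra) x1.
have {}x1 := sq_ge (29 / 33) (61 / 79) _ ltac:(lra) ltac:(lra) x1.
have {}x1 := sq_ge (61 / 79) (31 / 52) _ ltac:(lra) ltac:(lra) x1.
have {x1} := sq_ge (31 / 52) (27 / 76) _ ltac:(lra) ltac:(lra) x1.
have sq y : expR y ^+ 2 = expR (y + y) :> R by rewrite expRD expr2.
rewrite !sq; set y := (X in expR X); have -> : y = - 1 by rewrite /y; field.
rewrite expRN -[leRHS]div1r ler_pdivlMr ?expR_gt0//; lra.
Qed.

Lemma expR1_ge : 243 / 100 <= expR 1 :> R.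
Proof.
have e4 : expR 1 = expR (4%:R^-1) ^+ 4 :> R.
  by rewrite -expRM_natl; congr expR; field.
have : (5 / 4) ^+ 4 <= expR 1 :> R.
  rewrite e4 lerXn2r ?nnegrE ?expR_ge0//.
  by apply: le_trans (expR_ge1Dx _); lra.
by apply: le_trans; lra.
Qed.

(** When there are at most e^(k+1) coordinates, passing from the exponent
    2k+2 to 2k costs a factor e: this is the tangent inequality between v_i^2
    and 1/e, summed over i. *)
Lemma sum_lower_power I k (h : R) (v : I -> R) : 1 <= h ->
  #|I|%:R <= expR 1 ^+ k.+1 :> R -> moment k v <= h ->
  \sum_i v i ^+ k.*2 <= expR 1 * h.
Proof.
move=> h1 cI vh; set e := expR 1; have e0 : 0 < e by exact: expR_gt0.
have : \sum_i ((v i ^+ 2) ^+ k.+1 + k.+1%:R * (v i ^+ 2) ^+ k * (e^-1 - v i ^+ 2))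
    <= \sum_(i : I) e^-1 ^+ k.+1.
  by apply: ler_sum => i _; apply: tangent_nonneg; rewrite ?sqr_ge0 ?invr_ge0 ?ltW.
rewrite sumr_const -[leRHS]mulr_natl.
have -> : \sum_i ((v i ^+ 2) ^+ k.+1 +
     k.+1%:R * (v i ^+ 2) ^+ k * (e^-1 - v i ^+ 2))
   = k.+1%:R / e * (\sum_i v i ^+ k.*2) - k%:R * moment k v.
  rewrite /moment !mulr_sumr -sumrB; apply: eq_bigr => i _.
  rewrite -[k.*2.+2]doubleS -!muln2 ![(_ * 2)%N]mulnC !exprM -natr1 !exprS; ring.
move=> H.
have : #|I|%:R * e^-1 ^+ k.+1 <= 1.
  by rewrite exprVn ler_pdivrMr ?exprn_gt0// mul1r.
move=> /(le_trans H); rewrite lerBlDr => {}H.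
have k0 : 0 <= k%:R :> R by [].
have : k.+1%:R / e * (\sum_i v i ^+ k.*2) <= k.+1%:R * h.
  apply: le_trans H _; rewrite -natr1; nra.
by rewrite -mulrA ler_pM2l ?ltr0n// mulrC ler_pdivrMr// mulrC.
Qed.

Lemma lipschitz_moment J l (B d : R) (x y : J -> R) : 1 <= B ->
  (forall j, `|x j| <= B) -> (forall j, `|y j| <= B) ->
  (forall j, `|x j - y j| <= d) ->
  `|moment l x - moment l y| <= #|J|%:R * (l.*2.+2%:R * B ^+ l.*2.+2) * d.
Proof.
move=> B1 xB yB xy; rewrite /moment -sumrB; apply: le_trans (ler_norm_sum _ _ _) _.
rewrite -mulrA mulr_natl -sumr_const; apply: ler_sum => j _.
apply: le_trans (lipschitz_pow _ B1 (xB j) (yB j)) _.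
by rewrite ler_wpM2l// mulr_ge0 ?exprn_ge0 //; lra.
Qed.

(** Up to a factor and a rank-one term, the Hessian at v of the square of
    the l^(2k+2) norm, when the moment of v is 1. The positive eps lets the
    form control the sup norm of a displacement even where v vanishes. *)
Definition local_weight I eps k (v : I -> R) i : R :=
  k.*2.+1%:R * v i ^+ k.*2 + eps.

Definition local_form I eps k (v d : I -> R) : R :=
  \sum_i local_weight eps k v i * d i ^+ 2.

Lemma local_form_sup I eps k (v d : I -> R) (r : R) i :
  0 < eps -> eps <= 1 -> 0 <= r ->
  local_form eps k v d <= r ^+ 2 -> `|d i| <= r / eps.
Proof.
move=> eps0 eps1 r0 vd.
have w0 j : 0 <= k.*2.+1%:R * v j ^+ k.*2 by rewrite mulr_ge0 ?pow_even_ge0.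
have : eps * d i ^+ 2 <= r ^+ 2.
  apply: le_trans vd; rewrite /local_form (bigD1 i)//= -[leLHS]addr0; apply: lerD.
    by rewrite ler_wpM2r ?sqr_ge0// /local_weight lerDr.
  apply: sumr_ge0 => j _; rewrite mulr_ge0 ?sqr_ge0// /local_weight.
  by rewrite addr_ge0// ltW.
move=> h; have : (`|d i| * eps) ^+ 2 <= r ^+ 2.
  rewrite exprMn real_normK ?num_real//; apply: le_trans h.
  by rewrite mulrC ler_wpM2r ?sqr_ge0//; nra.
have e0 := ltW eps0.
by rewrite ler_pXn2r ?nnegrE ?mulr_ge0// ler_pdivlMr.
Qed.

Lemma le_of_moment I k (v : I -> R) i : moment k v <= 2 -> `|v i| <= 2.
Proof.
move=> v2; rewrite leNgt; apply/negP => vi.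
have v1 : 1 <= `|v i| by lra.
have : `|v i| ^+ k.*2.+2 <= 2.
  rewrite -normrX ger0_norm; last by rewrite -doubleS pow_even_ge0.
  by apply: le_trans v2; exact: le_moment.
apply/negP; rewrite -ltNge; apply: lt_le_trans vi _.
by rewrite exprS ler_peMr// exprn_ege1.
Qed.

(** Taylor's formula for step, uniform over the patch. D depends on the
    dimensions, which is harmless: r will be chosen small in terms of D. *)
Lemma linearize I J (A : J -> I -> R) k eps :
  (forall r i, `|A r i| <= 1) -> 0 < eps -> eps <= 1 ->
  exists2 D : R, 1 <= D & forall v u r, moment k v <= 2 -> 0 < r -> r <= 1 ->
    local_form eps k v (fun i => u i - v i) <= r ^+ 2 ->
    [/\ forall j, `|step A k u j - step A k v j -
          \sum_i A j i * (k.*2.+1%:R * v i ^+ k.*2 * (u i - v i))| <= D * r ^+ 2,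
        forall j,
          `|\sum_i A j i * (k.*2.+1%:R * v i ^+ k.*2 * (u i - v i))| <= D * r,
        forall j, `|step A k u j| <= D /\ `|step A k v j| <= D &
        `|moment k u - moment k v| <= D * r].
Proof.
(* Bound for the coordinates of v and of all u in the patch. *)
move=> A1 eps0 eps1; pose B : R := 2 + eps^-1.
have ieps : 1 <= eps^-1 by rewrite invf_ge1.
have B1 : 1 <= B by rewrite /B; lra.
pose a : R := #|I|%:R * (k.*2.+1%:R ^+ 2 * B ^+ k.*2.+1 * eps^-1 ^+ 2).
pose b : R := #|I|%:R * (k.*2.+1%:R * B ^+ k.*2 * eps^-1).
pose c : R := #|I|%:R * B ^+ k.*2.+1.
pose d : R := #|I|%:R * (k.*2.+2%:R * B ^+ k.*2.+2) * eps^-1.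
have B0 : 0 <= B by lra.
have ie0 : 0 <= eps^-1 by lra.
have Bn n : 0 <= B ^+ n by exact: exprn_ge0.
have a0 : 0 <= a.
  apply: mulr_ge0 => //; apply: mulr_ge0; last exact: sqr_ge0.
  by apply: mulr_ge0 => //; exact: sqr_ge0.
have b0 : 0 <= b by repeat (apply: mulr_ge0 => //).
have c0 : 0 <= c by repeat (apply: mulr_ge0 => //).
have d0 : 0 <= d by repeat (apply: mulr_ge0 => //).
exists (1 + a + b + c + d); first lra.
move=> v u r v2 r0 r1 uv.
have del i : `|u i - v i| <= r / eps by apply: local_form_sup uv => //; exact: ltW.
have vB i : `|v i| <= B by rewrite (le_trans (le_of_moment i v2))// /B; lra.
have reps : r / eps <= eps^-1 by rewrite ler_piMl//; lra.
have uB i : `|u i| <= B.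
  have -> : u i = v i + (u i - v i) by ring.
  rewrite (le_trans (ler_normD _ _))//; have := del i; have := le_of_moment i v2.
  by rewrite /B; lra.
have sumA (x : I -> R) (m : R) j : (forall i, `|x i| <= m) ->
    `|\sum_i A j i * x i| <= #|I|%:R * m.
  move=> xm; apply: le_trans (ler_norm_sum _ _ _) _.
  rewrite mulr_natl -sumr_const; apply: ler_sum => i _.
  by rewrite normrM -[m]mul1r ler_pM.
split.
- move=> j; apply: le_trans (_ : a * r ^+ 2 <= _); last first.
    by rewrite ler_wpM2r ?sqr_ge0//; lra.
  have -> : step A k u j - step A k v j -
      \sum_i A j i * (k.*2.+1%:R * v i ^+ k.*2 * (u i - v i)) =
      \sum_i A j i * (u i ^+ k.*2.+1 - v i ^+ k.*2.+1 -
         k.*2.+1%:R * v i ^+ k.*2 * (u i - v i)).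
    by rewrite /step -!sumrB; apply: eq_bigr => i _; ring.
  rewrite /a -mulrA; apply: sumA => i.
  apply: le_trans (pow_taylor1 _ B1 (uB i) (vB i)) _.
  rewrite -[leRHS]mulrA; apply: ler_wpM2l.
    by apply: mulr_ge0 => //; exact: sqr_ge0.
  rewrite -real_normK ?num_real// -exprMn lerXn2r ?nnegrE//.
    by apply: mulr_ge0 => //; exact: ltW.
  by rewrite mulrC.
- move=> j; apply: le_trans (_ : b * r <= _); last first.
    by rewrite ler_wpM2r ?ltW//; lra.
  rewrite /b -mulrA; apply: sumA => i.
  rewrite normrM -mulrA [_^-1 * r]mulrC; apply: ler_pM => //.
  rewrite normrM normr_nat ler_wpM2l// normrX lerXn2r ?nnegrE//.
- have sB w : (forall i, `|w i| <= B) ->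
      forall j, `|step A k w j| <= 1 + a + b + c + d.
    move=> wB j; apply: le_trans (_ : c <= _); last lra.
    by apply: sumA => i; rewrite normrX lerXn2r ?nnegrE.
  by move=> j; split; exact: sB.
- apply: le_trans (lipschitz_moment k B1 uB vB del) _.
  rewrite [leLHS](_ : _ = d * r); last by rewrite /d; ring.
  by apply: ler_wpM2r; [exact: ltW|lra].
Qed.

(** Double counting of the pairs (w, s) with w in F s. The sets F s need not
    cover E: it is enough that each w of E lies in F s for a positive fraction
    of the s, so no logarithmic factor is lost to a union bound. *)
Lemma fractional_cover Om Si (E : {set Om}) (F : Si -> {set Om}) (p b : R) :
  (0 < #|Si|)%N ->
  (forall w, w \in E -> p * #|Si|%:R <= #|[set s | w \in F s]|%:R) ->
  (forall s, #|F s|%:R <= b) -> p * #|E|%:R <= b.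
Proof.
move=> Si0 EF Fb; have Sp : 0 < #|Si|%:R :> R by rewrite ltr0n.
rewrite -(ler_pM2r Sp).
apply: le_trans (_ : \sum_(w in E) p * #|Si|%:R <= _).
  by rewrite sumr_const -[leRHS]mulr_natl; lra.
apply: le_trans (_ : \sum_(w in E) (#|[set s | w \in F s]|%:R) <= _).
  exact: ler_sum.
apply: le_trans (_ : \sum_w \sum_s (w \in F s)%:R <= _).
  rewrite [leRHS](bigID (mem E))/= -[leLHS]addr0; apply: lerD.
    apply: ler_sum => w _; rewrite -sum1_card natr_sum big_mkcond/=.
    by apply: ler_sum => s _; rewrite inE; case: (w \in _).
  by apply: sumr_ge0 => w _; apply: sumr_ge0.
rewrite exchange_big/= [leRHS]mulrC mulr_natl -sumr_const; apply: ler_sum => s _.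
apply: le_trans (Fb s); rewrite -sum1_card natr_sum [leRHS]big_mkcond/=.
by apply: ler_sum => w _; case: (w \in _).
Qed.

End Local.

(** * Random centres of patches *)

Section RandomCenters.
Variable R : realType.
Variables (I J : finType) (A : J -> I -> R) (k : nat).
Hypothesis A1 : forall j i, `|A j i| <= 1.
Variables (K : nat) (X : R).
Hypotheses (X0 : 0 < X) (XK : X <= K%:R).

Lemma sum_dup (F : I -> R) :
  \sum_(s : I * 'I_K) F s.1 = K%:R * \sum_i F i.
Proof.
rewrite -(pair_bigA _ (fun i (_ : 'I_K) => F i))/= mulr_sumr.
by apply: eq_bigr => i _; rewrite sumr_const card_ord mulr_natl.
Qed.

Let K0 : 0 < K%:R :> R. Proof. exact: lt_le_trans XK. Qed.

(** The K signs of a coordinate add up to a variable of variance 1 / X. *)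
Definition sign_scale : R := Num.sqrt (X * K%:R)^-1.

Lemma sign_scale_ge0 : 0 <= sign_scale. Proof. exact: sqrtr_ge0. Qed.

Lemma sign_scaleE : sign_scale ^+ 2 = (X * K%:R)^-1.
Proof. by rewrite sqr_sqrtr// invr_ge0 mulr_ge0// ltW. Qed.

Definition gain (v : I -> R) i : R := Num.sqrt (k.*2.+1%:R * v i ^+ k.*2).

Lemma gainE v i : gain v i ^+ 2 = k.*2.+1%:R * v i ^+ k.*2.
Proof. by rewrite sqr_sqrtr// mulr_ge0// pow_even_ge0. Qed.

Definition direction v (s : I * 'I_K) (j : J) : R :=
  sign_scale * gain v s.1 * A j s.1.

(** The means of the signs for which the random centre of v is, to first
    order, the image of u. *)
Definition drift (v u : I -> R) (r : R) (s : I * 'I_K) : R :=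
  sign_scale * X * (gain v s.1 * ((u s.1 - v s.1) / r)).

Lemma sum_sqr_gain eps v u r : 0 < r -> 0 <= eps ->
  local_form eps k v (fun i => u i - v i) <= r ^+ 2 ->
  \sum_i (gain v i * ((u i - v i) / r)) ^+ 2 <= 1.
Proof.
move=> r0 eps0 uv; rewrite -(@ler_pM2r _ (r ^+ 2)) ?exprn_gt0// mul1r mulr_suml.
apply: le_trans uv; apply: ler_sum => i _; rewrite exprMn gainE expr_div_n.
rewrite -mulrA divfK ?expf_neq0 ?gt_eqF//.
by rewrite ler_wpM2r ?sqr_ge0// /local_weight lerDl.
Qed.

Lemma sum_sqr_drift eps v u r : 0 < r -> 0 <= eps ->
  local_form eps k v (fun i => u i - v i) <= r ^+ 2 ->
  \sum_s drift v u r s ^+ 2 <= X.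
Proof.
move=> r0 eps0 uv.
rewrite (sum_dup (fun i => (sign_scale * X * (gain v i * ((u i - v i) / r))) ^+ 2)).
under eq_bigr do rewrite exprMn.
rewrite -mulr_sumr exprMn sign_scaleE mulrA.
have -> : K%:R * ((X * K%:R)^-1 * X ^+ 2) = X.
  by field; rewrite !gt_eqF.
by rewrite ler_piMr ?(ltW X0)// (sum_sqr_gain r0 eps0 uv).
Qed.

(** This is why each coordinate gets K signs: a displacement concentrated on
    one coordinate still needs means of absolute value at most 1. *)
Lemma drift_le1 eps v u r s : 0 < r -> 0 <= eps ->
  local_form eps k v (fun i => u i - v i) <= r ^+ 2 -> `|drift v u r s| <= 1.
Proof.
move=> r0 eps0 uv; have := sum_sqr_gain r0 eps0 uv.
rewrite (bigD1 s.1)//=.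
have : 0 <= \sum_(i | i != s.1) (gain v i * ((u i - v i) / r)) ^+ 2.
  by apply: sumr_ge0 => i _; rewrite sqr_ge0.
rewrite /drift; move: (gain _ _ * _) (\sum_(_ | _) _) => x y y0 xy.
have x1 : x ^+ 2 <= 1 by lra.
rewrite -(@ler_pXn2r _ 2)// ?nnegrE// expr1n real_normK ?num_real//.
rewrite !exprMn sign_scaleE.
have -> : (X * K%:R)^-1 * X ^+ 2 = X / K%:R by field; rewrite !gt_eqF.
have XK0 : 0 <= X / K%:R by rewrite divr_ge0// ltW.
by rewrite mulr_ile1 ?sqr_ge0// ler_pdivrMr// mul1r.
Qed.

Lemma sum_direction_drift v u r j : 0 < r ->
  \sum_s direction v s j * drift v u r s =
  (\sum_i A j i * (k.*2.+1%:R * v i ^+ k.*2 * (u i - v i))) / r.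
Proof.
move=> r0; rewrite (sum_dup (fun i => (sign_scale * gain v i * A j i) *
   (sign_scale * X * (gain v i * ((u i - v i) / r))))).
rewrite mulr_sumr mulr_suml; apply: eq_bigr => i _.
rewrite -gainE (_ : K%:R * _ = K%:R * X * sign_scale ^+ 2 *
   (gain v i ^+ 2 * A j i * ((u i - v i) / r))); last by ring.
by rewrite sign_scaleE; field; rewrite !gt_eqF.
Qed.

(** The Hilbert-Schmidt bound for the derivative of a step, between the
    weights at v and the weights W: the entries of A are at most 1, so only
    the total masses of both families of weights matter. *)
Lemma sum_sqr_direction v (W : J -> R) (a b : R) : (forall j, 0 <= W j) ->
  \sum_i v i ^+ k.*2 <= a -> \sum_j W j <= b ->
  \sum_s \sum_j W j * direction v s j ^+ 2 <= k.*2.+1%:R * a * b / X.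
Proof.
move=> W0 va Wb.
apply: le_trans (_ : \sum_(s : I * 'I_K) \sum_j
    W j * (sign_scale ^+ 2 * gain v s.1 ^+ 2) <= _).
  apply: ler_sum => s _; apply: ler_sum => j _; rewrite ler_wpM2l//.
  have : A j s.1 ^+ 2 <= 1 by rewrite -real_normK ?num_real// exprn_ile1.
  have : 0 <= sign_scale ^+ 2 * gain v s.1 ^+ 2 by rewrite mulr_ge0// sqr_ge0.
  by rewrite /direction !exprMn; nra.
under eq_bigr do rewrite -mulr_suml.
rewrite (sum_dup (fun i => (\sum_j W j) * (sign_scale ^+ 2 * gain v i ^+ 2))).
rewrite -!mulr_sumr sign_scaleE.
have -> : \sum_i gain v i ^+ 2 = k.*2.+1%:R * \sum_i v i ^+ k.*2.
  by rewrite mulr_sumr; apply: eq_bigr => i _; exact: gainE.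
set w := \sum_j W j in Wb *; set x := \sum_i _ in va *.
have w0 : 0 <= w by apply: sumr_ge0.
have x0 : 0 <= x by apply: sumr_ge0 => i _; exact: pow_even_ge0.
have -> : K%:R * (w * ((X * K%:R)^-1 * (k.*2.+1%:R * x))) =
   k.*2.+1%:R * (x * w) / X by field; rewrite !gt_eqF.
rewrite ler_pM2r ?invr_gt0// -[leRHS]mulrA ler_wpM2l//.
by rewrite ler_pM.
Qed.

Lemma abs_direction v s j : moment k v <= 2 ->
  `|direction v s j| <= sign_scale * (k.*2.+1%:R * 2 ^+ k.*2).
Proof.
move=> v2; rewrite /direction !normrM (ger0_norm sign_scale_ge0) -mulrA.
rewrite ler_wpM2l ?sign_scale_ge0// -[leRHS]mulr1 ler_pM// ger0_norm ?sqrtr_ge0//.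
set M := _ * _; have M1 : 1 <= M.
  by rewrite /M mulr_ege1 ?exprn_ege1 ?ler1n.
have : gain v s.1 ^+ 2 <= M.
  rewrite gainE ler_wpM2l//.
  have <- : `|v s.1| ^+ k.*2 = v s.1 ^+ k.*2.
    by rewrite -normrX ger0_norm// pow_even_ge0.
  by rewrite lerXn2r ?nnegrE// (le_of_moment _ v2).
rewrite -/(gain v s.1); have : 0 <= gain v s.1 by exact: sqrtr_ge0.
by move: (gain _ _) => x; nra.
Qed.

Lemma sum_abs_direction v j : moment k v <= 2 ->
  \sum_s `|direction v s j| <=
    #|{: I * 'I_K}|%:R * (sign_scale * (k.*2.+1%:R * 2 ^+ k.*2)).
Proof.
move=> v2; rewrite mulr_natl -sumr_const; apply: ler_sum => s _.
exact: abs_direction.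
Qed.

End RandomCenters.

(** * Constants of one half step *)

Section HalfStep.
Variable R : realType.
Implicit Types (I J Om : finType) (k l : nat).

(** Bound for the squared Hilbert-Schmidt norm of the derivative of a step
    in the local metrics. *)
Definition trace_bound k l : R := k.*2.+1%:R * l.*2.+1%:R * expR 1 ^+ 2.

(** The bound of many_close_signs for X = 3 * trace_bound k l and
    tau / q <= 50 / 51. *)
Definition cover_prob k l : R := expR (- (3 * trace_bound k l)) / 51 ^+ 2.

Lemma inverse_root n (P : R) : 0 < P -> exists2 c : R, 0 < c & c ^+ n.+1 * P = 1.
Proof.
move=> P0; exists (expR (- ln P / n.+1%:R)); first exact: expR_gt0.
by rewrite -expRM_natr divfK ?pnatr_eq0// expRN lnK// mulVf// gt_eqF.
Qed.

Lemma bernoulli (x : R) n : 0 <= x -> x <= 1 -> 1 - n%:R * x <= (1 - x) ^+ n.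
Proof.
move=> x0 x1; elim: n => [|n IHn]; first by rewrite expr0 mul0r subr0.
have : 0 <= n%:R :> R by [].
have y0 : 0 <= 1 - x by lra.
have := ler_wpM2l y0 IHn; rewrite exprS.
rewrite -natr1; nra.
Qed.

Lemma trace_ge1 k l : 1 <= trace_bound k l.
Proof.
have e1 : 1 <= expR 1 :> R by have := expR1_ge R; lra.
by rewrite /trace_bound !mulr_ege1 ?ler1n// exprn_ege1.
Qed.

(** Near a normalized point, Bernoulli's inequality absorbs the exponent
    that occurs in nondecaying. *)
Lemma nondecaying_moment_step I J (A : J -> I -> R) k l (eta : R) u :
  0 < eta -> 2 * eta * (k.*2.+1 * l.+1)%:R <= 1 / 1000 ->
  1 - 2 * eta <= moment k u -> nondecaying A k l u ->
  999 / 1000 <= moment l (step A k u).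
Proof.
move=> eta0 heta ku; rewrite /nondecaying; set P := moment l _ => gu.
rewrite leNgt; apply/negP => P1; have P0 : 0 <= P by exact: moment_ge0.
have n1 : 1 <= (k.*2.+1 * l.+1)%:R :> R by rewrite ler1n muln_gt0.
have eta1 : 2 * eta <= 1 by nra.
have eta2 : 0 <= 2 * eta by lra.
have b := bernoulli (k.*2.+1 * l.+1) eta2 eta1.
have : (1 - 2 * eta) ^+ (k.*2.+1 * l.+1) <= moment k u ^+ (k.*2.+1 * l.+1).
  by rewrite lerXn2r ?nnegrE ?moment_ge0// subr_ge0.
have : P ^+ k.+1 <= P by rewrite exprS ler_piMr// exprn_ile1//; lra.
lra.
Qed.

Lemma small_radius (a b : seq R) : (forall y, y \in b -> 0 < y) ->
  exists2 r0 : R, 0 < r0 & forall r, 0 < r -> r <= r0 ->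
    forall x y, x \in a -> y \in b -> x * r <= y.
Proof.
move=> b0.
have [m m0 mb] : exists2 m : R, 0 < m & forall y, y \in b -> m <= y.
  elim: b b0 => [|y b IHb] b0; first by exists 1.
  have [|m m0 mb] := IHb; first by move=> z zb; apply: b0; rewrite inE zb orbT.
  exists (Num.min y m); first by rewrite lt_min m0 b0// mem_head.
  by move=> z; rewrite inE ge_min => /orP[/eqP->|/mb->]; rewrite ?lexx ?orbT.
have [M M0 Ma] : exists2 M : R, 0 < M & forall x, x \in a -> x <= M.
  elim: a => [|x a [M M0 Ma]]; first by exists 1.
  exists (Num.max x M); first by rewrite lt_max M0 orbT.
  by move=> z; rewrite inE le_max => /orP[/eqP->|/Ma->]; rewrite ?lexx ?orbT.
exists (m / M); first by rewrite divr_gt0.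
move=> r r0; rewrite ler_pdivlMr// => rM x y xa yb.
apply: le_trans (mb _ yb); apply: le_trans rM; rewrite mulrC.
by rewrite ler_pM2l// Ma.
Qed.

Lemma normalizing_factor n (P : R) : 998 / 1000 <= P ->
  exists c : R, [/\ 0 < c, c ^+ n.+2 * P = 1, c ^+ 2 <= 100 / 99 & c <= 2].
Proof.
move=> P1; have P0 : 0 < P by lra.
have [c c0 cP] := inverse_root n.+1 P0.
have c2 : c ^+ 2 <= 100 / 99.
  have [c1|c1] := lerP c 1.
    by apply: (@le_trans _ _ 1); [rewrite exprn_ile1// ltW|lra].
  have : c ^+ 2 <= c ^+ n.+2 by rewrite ler_weXn2l// ltW.
  have : 0 <= c ^+ n.+2 by rewrite exprn_ge0// ltW.
  by move: cP; clear -P1; move: (c ^+ n.+2) (c ^+ 2) => x y; nra.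
exists c; split => //; clear -c2 c0; nra.
Qed.

Lemma weight_lipschitz J l eps (B d : R) (x y : J -> R) j : 1 <= B ->
  (forall j, `|x j| <= B) -> (forall j, `|y j| <= B) ->
  `|x j - y j| <= d -> l.*2.+1%:R * (l.*2%:R * B ^+ l.*2 * d) <= eps ->
  local_weight eps l x j <= l.*2.+1%:R * y j ^+ l.*2 + 2 * eps.
Proof.
move=> B1 xB yB xyd hd; rewrite /local_weight.
have h : x j ^+ l.*2 - y j ^+ l.*2 <= l.*2%:R * B ^+ l.*2 * d.
  apply: le_trans (ler_norm _) _.
  apply: le_trans (lipschitz_pow _ B1 (xB j) (yB j)) _.
  by rewrite ler_wpM2l// mulr_ge0// exprn_ge0//; lra.
have := ler_wpM2l (ler0n R l.*2.+1) h.
by clear -hd; lra.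
Qed.

(** The point r Y + err, rescaled by c, seen from the centre: Y is the
    deviation of the signs and err the quadratic error of the linearization,
    which contributes one more factor r. *)
Lemma capture J (wt W Y err : J -> R) (c r q C D w : R) :
  (forall j, wt j <= W j) -> (forall j, 0 <= W j) ->
  \sum_j W j <= w -> \sum_j W j * Y j ^+ 2 <= q ->
  (forall j, `|Y j| <= 2 * C) -> (forall j, `|err j| <= D * r ^+ 2) ->
  0 < r -> r <= 1 -> 0 <= C -> 0 <= D ->
  c ^+ 2 <= 100 / 99 ->
  \sum_j wt j * (c * (r * Y j + err j)) ^+ 2 <=
     100 / 99 * (q + w * (4 * C * D + D ^+ 2) * r) * r ^+ 2.
Proof.
move=> wtW W0 Ww Wq YC errD r0 r1 C0 D0 c2.
have sq j : (r * Y j + err j) ^+ 2 <=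
    r ^+ 2 * Y j ^+ 2 + (4 * C * D + D ^+ 2) * r * r ^+ 2.
  have YE : Y j * err j <= 2 * C * (D * r ^+ 2).
    by apply: le_trans (ler_norm _) _; rewrite normrM ler_pM.
  have EE : err j ^+ 2 <= (D * r ^+ 2) ^+ 2.
    by rewrite -real_normK ?num_real// lerXn2r ?nnegrE// (le_trans _ (errD j)).
  have h1 : r * (Y j * err j) <= r * (2 * C * (D * r ^+ 2)) by rewrite ler_pM2l.
  have h2 : (D * r ^+ 2) ^+ 2 <= D ^+ 2 * r * r ^+ 2.
    have : D ^+ 2 * r ^+ 3 * r <= D ^+ 2 * r ^+ 3 * 1.
      by rewrite ler_wpM2l// mulr_ge0 ?exprn_ge0// ltW.
    by clear; lra.
  by clear -EE h1 h2; lra.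
apply: le_trans (_ : \sum_j 100 / 99 * (W j * (r ^+ 2 * Y j ^+ 2 +
    (4 * C * D + D ^+ 2) * r * r ^+ 2)) <= _).
  apply: ler_sum => j _; rewrite exprMn mulrCA.
  set T := _ + _ * r * _ in sq *.
  have WT : wt j * (r * Y j + err j) ^+ 2 <= W j * T.
    apply: le_trans (ler_wpM2r (sqr_ge0 _) (wtW j)) _.
    by rewrite ler_wpM2l// sq.
  apply: le_trans (ler_wpM2l (sqr_ge0 c) WT) _.
  by rewrite ler_wpM2r// mulr_ge0// (le_trans (sqr_ge0 _) (sq j)).
rewrite -mulr_sumr -[leRHS]mulrA ler_wpM2l//.
under eq_bigr do rewrite mulrDr mulrCA.
rewrite big_split/= -mulr_sumr -mulr_suml.
have m0 : 0 <= (4 * C * D + D ^+ 2) * r * r ^+ 2.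
  rewrite mulr_ge0 ?sqr_ge0// mulr_ge0 ?(ltW r0)// addr_ge0 ?sqr_ge0//.
  by rewrite !mulr_ge0.
have := ler_wpM2r m0 Ww; have := ler_wpM2l (sqr_ge0 r) Wq.
by clear; lra.
Qed.

End HalfStep.

(** * One half step *)

Section HalfStep.
Variable R : realType.
Implicit Types (I J Om : finType) (k l : nat).

(** The choice of q, just below 1/e. It leaves room for the errors within the
    target radius e^(-1/2) r, and stays above tau, which is about 1/3 because
    X is 3 times the Hilbert-Schmidt bound; this uses e <= 2.82. Here a bounds
    the moment of the centre and w the total mass of the target weights. *)
Lemma capture_constants k l (a w q tau : R) :
  1 <= a -> a <= 1001 / 1000 ->
  w = l.*2.+1%:R * expR 1 + 1 / 1000 -> q = 98 / 100 / expR 1 ->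
  tau = k.*2.+1%:R * (expR 1 * a) * w / (3 * trace_bound R k l) ->
  [/\ 0 < q, tau <= 50 / 51 * q & 100 / 99 * (q + 1 / 1000) <= (expR 1)^-1].
Proof.
rewrite /trace_bound => a1 a2 -> -> ->.
have := expR1_le R; have := expR1_ge R; move: (expR 1) => e e1 e2.
have e0 : 0 < e by lra.
have ie1 : 1 / 3 <= e^-1 by rewrite -[e^-1]div1r ler_pdivlMr//; lra.
split; [by rewrite divr_gt0| |by lra].
have k1 : 1 <= k.*2.+1%:R :> R by rewrite ler1n.
have l1 : 1 <= l.*2.+1%:R :> R by rewrite ler1n.
move: (k.*2.+1%:R) (l.*2.+1%:R) k1 l1 => x y x1 y1.
have -> : x * (e * a) * (y * e + 1 / 1000) / (3 * (x * y * e ^+ 2)) =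
   a / 3 * (1 + 1 / 1000 * (y * e)^-1).
  by field; rewrite !gt_eqF//; lra.
have ye : (y * e)^-1 <= 1.
  by rewrite invf_le1 ?mulr_gt0//; [nra|lra].
have ye0 : 0 <= (y * e)^-1 by rewrite invr_ge0 mulr_ge0//; lra.
have h : a / 3 * (1 + 1 / 1000 * (y * e)^-1) <= 1001 / 1000 / 3 * (1 + 1 / 1000).
  by apply: ler_pM; lra.
apply: le_trans h _.
have : e^-1 * e = 1 by rewrite mulVf// gt_eqF.
by move: e^-1 ie1 => z z1; clear -z1 e1 e2; nra.
Qed.

(** A point of the patch in the form v + r d has image step v + r L d up to
    O(r^2), where L has bounded Hilbert-Schmidt norm. The centres are
    step v + r L applied to scaled random signs; all are divided by the norm
    of step v, so that they are again nearly normalized. The nondecaying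
    point in the patch keeps this norm away from 0. *)
Lemma half_step_geometry I J (A : J -> I -> R) k l (eps eta : R) :
  (forall j i, `|A j i| <= 1) -> 0 < eps -> eps <= 1 -> 0 < eta ->
  #|I|%:R <= expR 1 ^+ k.+1 :> R -> #|J|%:R <= expR 1 ^+ l.+1 :> R ->
  2 * eta * (k.*2.+1 * l.+1)%:R <= 1 / 1000 ->
  2 * eps * #|J|%:R <= 1 / 1000 ->
  exists2 r0 : R, 0 < r0 & forall r v, 0 < r -> r <= r0 ->
    `|moment k v - 1| <= eta ->
    (exists2 u, nondecaying A k l u &
       local_form eps k v (fun i => u i - v i) <= r ^+ 2) ->
    exists (S : finType) (ctr : {ffun S -> bool} -> J -> R) (c : R),
    [/\ 0 < c, forall s, `|moment l (ctr s) - 1| <= eta &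
      forall u, local_form eps k v (fun i => u i - v i) <= r ^+ 2 ->
      cover_prob R k l * (2 ^ #|S|)%:R <=
      #|[set s | local_form eps l (ctr s) (fun j => c * step A k u j - ctr s j)
                  <= (expR (- 2^-1) * r) ^+ 2]|%:R].
Proof.
move=> A1 eps0 eps1 eta0 cI cJ heta heps.
have [D D1 lin] := linearize k A1 eps0 eps1.
have n1 : 1 <= (k.*2.+1 * l.+1)%:R :> R by rewrite ler1n muln_gt0.
have eta1 : eta <= 1 / 1000.
  have : 2 * eta * 1 <= 2 * eta * (k.*2.+1 * l.+1)%:R by rewrite ler_pM2l//; lra.
  by clear -heta eta0; lra.
pose X : R := 3 * trace_bound R k l.
have X0 : 0 < X by rewrite mulr_gt0// (lt_le_trans _ (trace_ge1 R k l)).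
have [K XK] : exists K, X <= K%:R.
  by exists (Num.truncn X).+1; rewrite ltW// truncnS_gt.
have [C C0 dirC] : exists2 C : R, 0 <= C & forall v j, moment k v <= 2 ->
    \sum_s `|@direction R I J A k K X v s j| <= C.
  exists (#|{: I * 'I_K}|%:R * (sign_scale K X * (k.*2.+1%:R * 2 ^+ k.*2))).
    by rewrite mulr_ge0// mulr_ge0 ?sign_scale_ge0// mulr_ge0 ?exprn_ge0.
  by move=> v j; exact: sum_abs_direction.
have [B [B1 BD BC]] : exists B, [/\ 1 <= B, 2 * D <= B & 2 * D + 2 * C <= B].
  by exists (2 * D + 2 * C); clear -D1 C0; split; lra.
pose w : R := l.*2.+1%:R * expR 1 + 1 / 1000.
(* The Lipschitz constants of the estimates below, each of which holds once
   its product with r is below every margin. *)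
pose rates : seq R :=
  [:: 1; D; #|J|%:R * (l.*2.+2%:R * D ^+ l.*2.+2) * (2 * D);
      #|J|%:R * (l.*2.+2%:R * B ^+ l.*2.+2) * (2 * C);
      l.*2.+1%:R * (l.*2%:R * B ^+ l.*2 * (2 * C));
      w * (4 * C * D + D ^+ 2)].
pose margins : seq R := [:: 1 / 1000; eps; eta].
have margins_gt0 y : y \in margins -> 0 < y.
  by rewrite !inE => /or3P[] /eqP->; [lra| exact: eps0| exact: eta0].
have [r0 r00 r0P] := small_radius rates margins_gt0.
exists r0 => // r v r_gt0 /(r0P _ r_gt0) {r0P r0 r00} sm vN [u0 gu0 fu0].
have v2 : moment k v <= 2.
  by move: vN; rewrite ler_norml; clear -eta1 => /andP[_]; lra.
have r1 : r <= 1.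
  have := sm 1 (1 / 1000); rewrite !inE !eqxx => /(_ isT isT).
  by clear; lra.
have {}lin u := lin v u r v2 r_gt0 r1.
set z0 := step A k v.
have [c [c0 cz0 c2 cle2]] : exists c : R,
    [/\ 0 < c, c ^+ l.*2.+2 * moment l z0 = 1, c ^+ 2 <= 100 / 99 & c <= 2].
  apply: normalizing_factor; have [e1 e2 e3 e4] := lin _ fu0.
  have Dr : D * r <= eta by apply: sm; rewrite !inE eqxx ?orbT.
  have mu : 1 - 2 * eta <= moment k u0.
    by move: vN e4; rewrite !ler_norml; clear -Dr => /andP[? ?] /andP[? ?]; lra.
  have zu := nondecaying_moment_step eta0 heta mu gu0.
  have zz j : `|step A k u0 j - z0 j| <= 2 * D * r.
    have := e1 j; have := e2 j; move: (\sum_i _) => t.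
    have : D * r ^+ 2 <= D * r.
      by clear -D1 r1 r_gt0; rewrite ler_pM2l; [rewrite expr2; nra|lra].
    move=> h1 h2 h3; rewrite -(subrK t (_ - z0 j)).
    by apply: le_trans (ler_normD _ _) _; clear -h1 h2 h3; lra.
  have := lipschitz_moment l D1 (fun j => (e3 j).1) (fun j => (e3 j).2) zz.
  rewrite mulrA => h.
  have : #|J|%:R * (l.*2.+2%:R * D ^+ l.*2.+2) * (2 * D) * r <= 1 / 1000.
    by apply: sm; rewrite !inE eqxx ?orbT.
  move: h; rewrite ler_norml; clear -zu => /andP[_].
  by move: (_ * r) (moment l z0) => x y; lra.
(* The weights are taken at zeta, which is exactly normalized and does not
   depend on the signs. *)
pose zeta j := c * z0 j.
have zetaB j : `|zeta j| <= 2 * D.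
  have [_ _ e3 _] := lin _ fu0.
  rewrite normrM (gtr0_norm c0).
  by apply: ler_pM => //; [exact: ltW|exact: (e3 j).2].
have mzeta : moment l zeta = 1 by rewrite moment_scale.
pose dir := @direction R I J A k K X v.
pose ctr (s : {ffun I * 'I_K -> bool}) j :=
  c * (z0 j + r * \sum_i dir i j * sign_of R (s i)).
have ctr_zeta s j : `|ctr s j - zeta j| <= 2 * C * r.
  have -> : ctr s j - zeta j = c * (r * \sum_i dir i j * sign_of R (s i)).
    by rewrite /ctr /zeta; ring.
  rewrite !normrM (gtr0_norm c0) (gtr0_norm r_gt0) [r * _]mulrC mulrA ler_pM2r//.
  apply: ler_pM => //; first exact: ltW.
  apply: le_trans (dirC v j v2); apply: le_trans (ler_norm_sum _ _ _) _.
  apply: ler_sum => i _; rewrite normrM ler_piMr// /sign_of.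
  by case: (s i); rewrite ?normrN normr1.
have ctrB s j : `|ctr s j| <= B.
  have := ctr_zeta s j; have := zetaB j; have : 2 * C * r <= 2 * C.
    by rewrite ler_piMr//; clear -C0; lra.
  move=> h1 h2 h3; rewrite -(subrK (zeta j) (ctr s j)).
  by apply: le_trans (ler_normD _ _) _; clear -h1 h2 h3 BC; lra.
have zetaB' j : `|zeta j| <= B by apply: le_trans (zetaB j) BD.
pose W j := l.*2.+1%:R * zeta j ^+ l.*2 + 2 * eps.
have W0 j : 0 <= W j.
  by rewrite addr_ge0 ?mulr_ge0 ?pow_even_ge0// ltW.
have Ww : \sum_j W j <= w.
  rewrite /W big_split/= -mulr_sumr; apply: lerD; last first.
    rewrite sumr_const -[_ *+ _]mulr_natr. exact: heps.
  apply: ler_wpM2l => //.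
  have := @sum_lower_power R J l 1 zeta (lexx _) cJ; rewrite mulr1; apply.
  by rewrite mzeta.
have wt s j : local_weight eps l (ctr s) j <= W j.
  apply: (weight_lipschitz B1 (ctrB s) zetaB' (ctr_zeta s j)).
  rewrite [X in _ * X]mulrA mulrA; apply: sm; rewrite !inE eqxx ?orbT//.
have e0 := expR_gt0 (1 : R).
have a1 : 1 <= 1 + eta by clear -eta0; lra.
have a2 : 1 + eta <= 1001 / 1000 by clear -eta1; lra.
have [q0 tq qe] := @capture_constants k l (1 + eta) w _ _ a1 a2 erefl erefl erefl.
set q := 98 / 100 / expR 1 in q0 tq qe.
set tau := (T in T <= _) in tq.
exists (I * 'I_K)%type, ctr, c; split => //.
  move=> s; rewrite -[1]mzeta.
  apply: le_trans (lipschitz_moment l B1 (ctrB s) zetaB' (ctr_zeta s)) _.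
  by rewrite mulrA; apply: sm; rewrite !inE eqxx ?orbT.
move=> u fu.
have thX := sum_sqr_drift X0 XK r_gt0 (ltW eps0) fu.
have th1 s := drift_le1 X0 XK s r_gt0 (ltW eps0) fu.
have vk : \sum_i v i ^+ k.*2 <= expR 1 * (1 + eta).
  apply: sum_lower_power => //.
  by move: vN; rewrite ler_norml; clear => /andP[_]; lra.
have dirtau := sum_sqr_direction A1 X0 XK W0 vk Ww.
have tauq : tau <= q by apply: le_trans tq _; clear -q0; lra.
have many := many_close_signs th1 W0 q0 thX dirtau tauq.
apply: (@le_trans _ _ ((1 - tau / q) ^+ 2 * expR (- X) * (2 ^ #|{: I * 'I_K}|)%:R)).
  rewrite ler_pM2r ?ltr0n ?expn_gt0// /cover_prob mulrC -/X ler_pM2r ?expR_gt0//.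
  have t1 : 1 / 51 <= 1 - tau / q.
    have : tau / q <= 50 / 51 by rewrite ler_pdivrMr.
    by clear; lra.
  rewrite -exprVn lerXn2r ?nnegrE ?invr_ge0//.
    by clear -t1; lra.
  by clear -t1; lra.
apply: le_trans many _; rewrite ler_nat.
apply: subset_leq_card; apply/fintype.subsetP => s.
rewrite !inE => dev.
pose Y j := \sum_i dir i j * (drift k X v u r i - sign_of R (s i)).
pose lj j := \sum_i A j i * (k.*2.+1%:R * v i ^+ k.*2 * (u i - v i)).
pose err j := step A k u j - z0 j - lj j.
have [e1 e2 e3 e4] := lin _ fu.
have cE j : c * step A k u j - ctr s j = c * (r * Y j + err j).
  have : r * Y j = lj j - r * \sum_i dir i j * sign_of R (s i).
    have := sum_direction_drift A k X0 XK v u j r_gt0; rewrite -/(lj j) => dd.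
    rewrite /Y; under eq_bigr do rewrite mulrBr.
    rewrite sumrB dd; field; exact: lt0r_neq0.
  by rewrite /ctr /err => ->; ring.
have YC j : `|Y j| <= 2 * C.
  apply: le_trans (_ : \sum_i `|dir i j| * 2 <= _); last first.
    by rewrite -mulr_suml mulrC ler_wpM2l// dirC.
  apply: le_trans (ler_norm_sum _ _ _) _; apply: ler_sum => i _.
  rewrite normrM ler_wpM2l//; apply: le_trans (ler_normB _ _) _.
  have := th1 i; rewrite /sign_of; case: (s i); rewrite ?normrN normr1; clear; lra.
rewrite /local_form; under eq_bigr do rewrite cE.
apply: le_trans (capture (wt s) W0 Ww dev YC e1 r_gt0 r1 C0 _ c2) _.
  by clear -D1; lra.
rewrite [leRHS]exprMn ler_pM2r ?exprn_gt0//.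
have -> : expR (- 2^-1) ^+ 2 = (expR 1)^-1 :> R.
  by rewrite expr2 -expRD -expRN; congr expR; field.
apply: le_trans qe; rewrite ler_pM2l// lerD2l.
by apply: sm; rewrite !inE eqxx ?orbT.
Qed.

End HalfStep.

(** * Counting bad functionals *)

Section Counting.
Variable R : realType.
Implicit Types (I J Om : finType) (k l d : nat).

(** G will be nondecaying: a step may shrink the norm of other points, and
    the patches around their images could not be normalized. *)
Definition bad_in_patch Om I eps k (G : (I -> R) -> Prop)
    (bad : (I -> R) -> Om -> Prop) v (r : R) : {set Om} :=
  [set w | `[< exists u, [/\ G u, local_form eps k v (fun i => u i - v i) <= r ^+ 2
                            & bad u w] >]]%SET.

(** Factor e^(-1/2) between the radii of successive patches. *)
Definition contraction : R := expR (- 2^-1).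

(** The recursion for counts: if step A k u is bad for w and u lies in the
    patch, then w is bad in the smaller patch around a fraction cover_prob of
    the random centres, whatever u is; average over the centres. *)
Lemma half_step I J (A : J -> I -> R) k l (eps eta : R) :
  (forall j i, `|A j i| <= 1) -> 0 < eps -> eps <= 1 -> 0 < eta ->
  #|I|%:R <= expR 1 ^+ k.+1 :> R -> #|J|%:R <= expR 1 ^+ l.+1 :> R ->
  2 * eta * (k.*2.+1 * l.+1)%:R <= 1 / 1000 ->
  2 * eps * #|J|%:R <= 1 / 1000 ->
  exists2 r0 : R, 0 < r0 & forall r, 0 < r -> r <= r0 ->
    forall Om (bad : (J -> R) -> Om -> Prop) (b : R), 0 <= b ->
    (forall c z w, 0 < c -> bad z w -> bad (fun j => c * z j) w) ->
    (forall v, `|moment l v - 1| <= eta ->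
       #|bad_in_patch eps l (nondecaying (fun i j => A j i) l k) bad v
           (contraction * r)|%:R <= b) ->
    forall v, `|moment k v - 1| <= eta ->
      cover_prob R k l *
      #|bad_in_patch eps k (nondecaying A k l)
          (fun u => bad (step A k u)) v r|%:R <= b.
Proof.
move=> A1 eps0 eps1 eta0 cI cJ heta heps.
have [r0 r00 geo] := half_step_geometry A1 eps0 eps1 eta0 cI cJ heta heps.
exists r0 => // r r_gt0 rr0 Om bad b b0 bad_scale bnd v vN.
set E := bad_in_patch _ _ _ _ _ _.
have [->|/finset.set0Pn[w0]] := eqVneq E finset.set0; first by rewrite cards0 mulr0.
rewrite inE => /asboolP[u0 [gu0 fu0 _]].
have [S [ctr [c [c0 ctrN cap]]]] := geo r v r_gt0 rr0 vN (ex_intro2 _ _ u0 gu0 fu0).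
pose F (s : {ffun S -> bool}) := bad_in_patch eps l
  (nondecaying (fun i j => A j i) l k) bad (ctr s) (contraction * r).
have cS : #|{: {ffun S -> bool}}| = (2 ^ #|S|)%N by rewrite card_ffun card_bool.
apply: (fractional_cover (F := F)).
- by rewrite cS expn_gt0.
- move=> w; rewrite inE => /asboolP[u [gu fu bu]]; rewrite cS.
  apply: le_trans (cap u fu) _; rewrite ler_nat.
  apply: subset_leq_card; apply/fintype.subsetP => s; rewrite !inE => hs.
  exists (fun j => c * step A k u j); split => //.
  - exact: (nondecaying_scale c0 (nondecaying_step gu)).
  - exact: bad_scale.
- by move=> s; exact: bnd.
Qed.

Lemma card_close_integers q (S : {set 'I_q}) (D : R) : 0 <= D ->
  (forall a b, a \in S -> b \in S -> (b : nat)%:R - (a : nat)%:R <= D) ->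
  #|S|%:R <= D + 1.
Proof.
move=> D0 SD; have [->|/finset.set0Pn[a0 Sa0]] := eqVneq S finset.set0.
  by rewrite cards0 addr_ge0.
case: (arg_minnP (fun a : 'I_q => a : nat) Sa0) => m Sm mmin.
pose f (a : 'I_q) : 'I_(Num.truncn D).+1 := inord (a - m).
have lt_f a : a \in S -> (a - m < (Num.truncn D).+1)%N.
  by move=> Sa; rewrite ltnS truncn_ge_nat// natrB ?mmin// SD.
have finj : {in S &, injective f}.
  move=> a b Sa Sb /(congr1 (@nat_of_ord _)); rewrite /f !inordK ?lt_f// => ab.
  by apply/val_inj; rewrite /= -(subnK (mmin a Sa)) ab subnK// mmin.
rewrite -(card_in_imset finj).
apply: le_trans (_ : (Num.truncn D).+1%:R <= _).
  by rewrite ler_nat (leq_trans (max_card _))// card_ord.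
by rewrite -natr1 lerD2r -truncn_ge_nat.
Qed.

(** On each line in the direction of the coordinate i0 the slab leaves
    2 T / kap + 1 integers at most. *)
Lemma thin_slab I q (v : I -> R) i0 (kap T : R) : 0 < kap -> kap <= `|v i0| ->
  0 <= T ->
  #|[set a : {ffun I -> 'I_q.+1} | `|\sum_i (a i : nat)%:R * v i| <= T]|%:R <=
    (2 * T / kap + 1) / q.+1%:R * #|{: {ffun I -> 'I_q.+1}}|%:R.
Proof.
move=> kap0 kapv T0; set E := [set a | _]%SET.
pose F (s : {ffun I -> 'I_q.+1}) : {set {ffun I -> 'I_q.+1}} :=
  [set a in E | [forall i, (i != i0) ==> (a i == s i)]]%SET.
have N0 : (0 < #|{: {ffun I -> 'I_q.+1}}|)%N.
  by rewrite card_ffun card_ord expn_gt0.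
set N := #|{: _}| in N0 *.
have Np : 0 < N%:R :> R by rewrite ltr0n.
suff h : q.+1%:R / N%:R * #|E|%:R <= 2 * T / kap + 1 :> R.
  rewrite [leRHS]mulrAC ler_pdivlMr ?ltr0n//.
  have := ler_wpM2r (ltW Np) h; congr (_ <= _).
  by field; rewrite gt_eqF.
apply: (fractional_cover (F := F)) => // [w wE|s].
- rewrite divfK ?gt_eqF// ler_nat.
  pose upd (a : 'I_q.+1) : {ffun I -> 'I_q.+1} :=
    [ffun i => if i == i0 then a else w i].
  have uinj : injective upd.
    by move=> a b /ffunP /(_ i0); rewrite !ffunE eqxx.
  rewrite -[X in (X <= _)%N]card_ord -(card_imset _ uinj).
  apply: subset_leq_card; apply/fintype.subsetP => s /imsetP[a _ ->].
  rewrite !inE in wE *; rewrite wE; apply/forallP => i; apply/implyP => ii0.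
  by rewrite ffunE (negbTE ii0).
- pose h (a : {ffun I -> 'I_q.+1}) := a i0.
  have hinj : {in F s &, injective h}.
    move=> a b; rewrite !inE => /andP[_ /forallP aF] /andP[_ /forallP bF] hab.
    apply/ffunP => i; have [->//|ii0] := eqVneq i i0.
    by move: (aF i) (bF i); rewrite ii0/= => /eqP-> /eqP->.
  rewrite -(card_in_imset hinj); apply: card_close_integers.
    by rewrite divr_ge0 ?mulr_ge0// ltW.
  move=> _ _ /imsetP[a aF ->] /imsetP[b bF ->].
  move: aF bF; rewrite !inE => /andP[aE /forallP aF] /andP[bE /forallP bF].
  (* Two functionals of the slab on the same line differ only at i0. *)
  have diff : \sum_i (b i : nat)%:R * v i - \sum_i (a i : nat)%:R * v i =
      ((h b : nat)%:R - (h a : nat)%:R) * v i0.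
    rewrite -sumrB (bigD1 i0)//= big1 => [|i ii0]; first by rewrite addr0 mulrBl.
    by move: (aF i) (bF i); rewrite ii0/= => /eqP-> /eqP->; rewrite subrr.
  have : `|((h b : nat)%:R - (h a : nat)%:R) * v i0| <= 2 * T.
    rewrite -diff; apply: le_trans (ler_normB _ _) _; clear -aE bE; lra.
  rewrite normrM => hT; rewrite ler_pdivlMr//; apply: le_trans hT.
  apply: le_trans (_ : `|(h b : nat)%:R - (h a : nat)%:R| * kap <= _).
    by rewrite ler_pM2r// ler_norm.
  by rewrite ler_wpM2l.
Qed.

Definition vanish I d q (u : I -> R) (w : {ffun 'I_d -> {ffun I -> 'I_q.+1}}) :=
  forall t, \sum_i (w t i : nat)%:R * u i = 0.

Lemma moment_large_coordinate I k (v : I -> R) : 1 / 2 <= moment k v ->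
  exists i, (2 * #|I|%:R)^-1 <= `|v i|.
Proof.
move=> v2; apply: contrapT => no.
have small i : `|v i| < (2 * #|I|%:R)^-1.
  by rewrite ltNge; apply/negP => ?; apply: no; exists i.
have I0 : (0 < #|I|)%N.
  rewrite lt0n; apply/negP => /eqP I0; move: v2.
  by rewrite /moment big1 ?lt_geF// => i _; move: (fintype0 i I0).
have I1 : 1 <= #|I|%:R :> R by rewrite ler1n.
have le1 : (2 * #|I|%:R)^-1 <= 1 :> R.
  by rewrite invf_le1; [|rewrite mulr_gt0// (lt_le_trans _ I1)]; lra.
suff : moment k v < 1 / 2 by rewrite ltNge v2.
apply: lt_le_trans (_ : \sum_(i : I) (2 * #|I|%:R)^-1 <= _); last first.
  rewrite sumr_const -[leLHS]mulr_natr (_ : _ * _ = 1 / 2)//.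
  by field; rewrite gt_eqF// ltr0n.
have [i0 _] := card_gt0P I0.
have lt i : v i ^+ k.*2.+2 < (2 * #|I|%:R)^-1.
  apply: le_lt_trans (small i).
  rewrite -[leLHS]ger0_norm -?doubleS ?pow_even_ge0// normrX doubleS exprS.
  rewrite ler_piMr// exprn_ile1//.
  by rewrite ltW// (lt_le_trans (small i)).
rewrite /moment (bigD1 i0)//= [ltRHS](bigD1 i0)//=; apply: ltr_leD => //.
by apply: ler_sum => i _; exact: ltW.
Qed.

(** If a functional kills a point of the patch then its value at v is of the
    order of r, and the d functionals are chosen independently. *)
Lemma base_count I eps k d q (G : (I -> R) -> Prop) v r :
  0 < eps -> eps <= 1 -> 0 <= r -> 1 / 2 <= moment k v ->
  #|bad_in_patch eps k G (@vanish I d q) v r|%:R <=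
    (4 * #|I|%:R ^+ 2 / eps * r + q.+1%:R^-1) ^+ d *
    #|{: {ffun 'I_d -> {ffun I -> 'I_q.+1}}}|%:R.
Proof.
move=> eps0 eps1 r0 v2; have [i0 vi0] := moment_large_coordinate v2.
have I1 : 1 <= #|I|%:R :> R by rewrite ler1n; apply/card_gt0P; exists i0.
have I0 : 0 < #|I|%:R :> R by lra.
have re0 : 0 <= r / eps by rewrite divr_ge0// ltW.
pose T : R := q.+1%:R * #|I|%:R * (r / eps).
have T0 : 0 <= T by apply: mulr_ge0 => //; apply: mulr_ge0.
pose E := [set a : {ffun I -> 'I_q.+1} | `|\sum_i (a i : nat)%:R * v i| <= T]%SET.
apply: le_trans (_ : (#|E| ^ d)%:R <= _).
  rewrite ler_nat.
  apply: leq_trans (_ : #|ffun_on (mem E) : {pred {ffun 'I_d -> _}}| <= _)%N.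
    apply: subset_leq_card; apply/fintype.subsetP => w; rewrite inE.
    move=> /asboolP[u [_ fu vu]]; apply/ffun_onP => t; rewrite inE.
    have -> : \sum_i (w t i : nat)%:R * v i =
        - \sum_i (w t i : nat)%:R * (u i - v i).
      under [in RHS]eq_bigr do rewrite mulrBr.
      by rewrite sumrB vu sub0r opprK.
    rewrite normrN; apply: le_trans (ler_norm_sum _ _ _) _.
    rewrite /T mulrAC mulr_natr -sumr_const; apply: ler_sum => i _.
    rewrite normrM normr_nat; apply: ler_pM => //.
      by rewrite ler_nat ltnW.
    exact: local_form_sup fu.
  by rewrite card_ffun_on card_ord.
have c1 : 0 <= 4 * #|I|%:R ^+ 2 / eps * r.
  apply: mulr_ge0 => //; apply: divr_ge0; last exact: ltW.
  by apply: mulr_ge0 => //; exact: sqr_ge0.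
rewrite [in leRHS]card_ffun card_ord !natrX -exprMn; apply: lerXn2r.
- by rewrite nnegrE.
- by rewrite nnegrE; apply: mulr_ge0 => //; apply: addr_ge0.
have k0 : 0 < (2 * #|I|%:R)^-1 :> R by rewrite invr_gt0 mulr_gt0.
apply: le_trans (thin_slab q k0 vi0 T0) _.
rewrite ler_wpM2r// /T invrK le_eqVlt; apply/orP; left; apply/eqP.
by field; rewrite nat1r pnatr_eq0/= gt_eqF.
Qed.

End Counting.

(** * Iterating the round trip *)

Section Iteration.
Variable R : realType.
Variables (I J : finType) (A : J -> I -> R) (k l : nat).

Definition round_trip (u : I -> R) : I -> R :=
  step (fun i j => A j i) l (step A k u).

Lemma iter_round_trip_scale j c u : 0 < c ->
  exists2 c' : R, 0 < c' & iter j round_trip (fun i => c * u i) =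
    (fun i => c' * iter j round_trip u i).
Proof.
move=> c0; elim: j => [|j [c' c'0 IHj]]; first by exists c.
exists ((c' ^+ k.*2.+1) ^+ l.*2.+1); first by rewrite !exprn_gt0.
by rewrite !iterS IHj /round_trip !step_scale.
Qed.

Lemma vanish_scale d q j c u (w : {ffun 'I_d -> {ffun I -> 'I_q.+1}}) : 0 < c ->
  vanish (iter j round_trip u) w ->
  vanish (iter j round_trip (fun i => c * u i)) w.
Proof.
move=> c0 uw t; have [c' c'0 ->] := iter_round_trip_scale j u c0.
by under eq_bigr do rewrite mulrCA; rewrite -mulr_sumr uw mulr0.
Qed.

Lemma cover_prob_gt0 : 0 < cover_prob R k l.
Proof. by rewrite divr_gt0 ?expR_gt0// exprn_gt0. Qed.

Lemma cover_probC : cover_prob R k l = cover_prob R l k.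
Proof.
by rewrite /cover_prob /trace_bound [l.*2.+1%:R * _]mulrC.
Qed.

Variables (eps eta : R).
Hypothesis A1 : forall j i, `|A j i| <= 1.
Hypotheses (eps0 : 0 < eps) (eps1 : eps <= 1) (eta0 : 0 < eta).
Hypotheses (cI : #|I|%:R <= expR 1 ^+ k.+1 :> R)
  (cJ : #|J|%:R <= expR 1 ^+ l.+1 :> R).
Hypotheses (hkl : 2 * eta * (k.*2.+1 * l.+1)%:R <= 1 / 1000)
  (hlk : 2 * eta * (l.*2.+1 * k.+1)%:R <= 1 / 1000).
Hypotheses (hI : 2 * eps * #|I|%:R <= 1 / 1000)
  (hJ : 2 * eps * #|J|%:R <= 1 / 1000).

Lemma contraction_gt0 : 0 < contraction R. Proof. exact: expR_gt0. Qed.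

Lemma contraction_le1 : contraction R <= 1.
Proof. by rewrite /contraction -[leRHS]expR0 ler_expR; lra. Qed.

(** Two half steps, one for A and one for its transpose, in each round
    trip. *)
Lemma iterated_count d : exists2 r0 : R, 0 < r0 &
  forall j q r v, 0 < r -> r <= r0 ->
  `|moment k v - 1| <= eta ->
  #|bad_in_patch eps k (nondecaying A k l)
     (fun u (w : {ffun 'I_d -> {ffun I -> 'I_q.+1}}) =>
        vanish (iter j round_trip u) w)
     v r|%:R <=
  (cover_prob R k l ^- 2) ^+ j *
    ((4 * #|I|%:R ^+ 2 / eps * ((contraction R ^+ 2) ^+ j * r) + q.+1%:R^-1) ^+ d *
    #|{: {ffun 'I_d -> {ffun I -> 'I_q.+1}}}|%:R).
Proof.
have [r1 r10 half1] := half_step A1 eps0 eps1 eta0 cI cJ hkl hJ.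
have [r2 r20 half2] := @half_step R J I (fun i j => A j i) l k eps eta
  (fun i j => A1 j i) eps0 eps1 eta0 cJ cI hlk hI.
have s0 := contraction_gt0; have s1 := contraction_le1.
have p0 := cover_prob_gt0.
exists (Num.min r1 r2) => [|j q]; first by rewrite lt_min r10.
set N : R := #|{: {ffun 'I_d -> {ffun I -> 'I_q.+1}}}|%:R; set C := 4 * _ / _.
have C0 : 0 <= C.
  apply: divr_ge0; last exact: ltW.
  by apply: mulr_ge0 => //; exact: sqr_ge0.
elim: j => [|j IHj] r v r0; rewrite le_min => /andP[rr1 rr2] vN.
  rewrite expr0 !mul1r; apply: base_count => //; first exact: ltW.
  have eta1 : eta <= 1 / 2.
    have n1 : 1 <= (k.*2.+1 * l.+1)%:R :> R by rewrite ler1n muln_gt0.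
    have := ler_wpM2l (ltW eta0) n1; move: hkl; rewrite mulr1 -mulrA.
    by move: (eta * _) => x; lra.
  by move: vN; rewrite ler_norml; move=> /andP[+ _]; lra.
have sr0 : 0 < contraction R * r by rewrite mulr_gt0.
have srr : contraction R * r <= r by rewrite ler_piMl// ltW.
set b : R := (cover_prob R k l ^- 2) ^+ j *
   ((C * ((contraction R ^+ 2) ^+ j * (contraction R * (contraction R * r))) +
     q.+1%:R^-1) ^+ d * N).
have b0 : 0 <= b.
  apply: mulr_ge0; first by rewrite exprn_ge0// invr_ge0 exprn_ge0// ltW.
  apply: mulr_ge0 => //; apply: exprn_ge0; apply: addr_ge0 => //.
  by rewrite mulr_ge0// mulr_ge0 ?exprn_ge0// ?ltW// mulr_gt0.
pose bad1 (u : I -> R) (w : {ffun 'I_d -> {ffun I -> 'I_q.+1}}) :=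
  vanish (iter j round_trip u) w.
pose bad2 (z : J -> R) (w : {ffun 'I_d -> {ffun I -> 'I_q.+1}}) :=
  bad1 (step (fun i j => A j i) l z) w.
have bad1_scale c u w : 0 < c -> bad1 u w -> bad1 (fun i => c * u i) w.
  by move=> c0; exact: vanish_scale.
have bad2_scale c z w : 0 < c -> bad2 z w -> bad2 (fun i => c * z i) w.
  by move=> c0 zw; rewrite /bad2 step_scale; apply: bad1_scale; rewrite ?exprn_gt0.
have step2 z : `|moment l z - 1| <= eta ->
    #|bad_in_patch eps l (nondecaying (fun i j => A j i) l k) bad2 z
        (contraction R * r)|%:R
      <= b / cover_prob R k l.
  move=> zN; rewrite ler_pdivlMr// mulrC cover_probC.
  apply: (half2 _ sr0 (le_trans srr rr2) _ bad1 b b0 bad1_scale _ z zN) => u uN.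
  have sr0' : 0 < contraction R * (contraction R * r) by rewrite mulr_gt0.
  have srr' : contraction R * (contraction R * r) <= r.
    by apply: le_trans srr; rewrite ler_piMl// ltW.
  have srr12 : contraction R * (contraction R * r) <= Num.min r1 r2.
    by rewrite le_min !(le_trans srr').
  exact: (IHj _ u sr0' srr12 uN).
have bp0 : 0 <= b / cover_prob R k l by rewrite divr_ge0// ltW.
have := half1 _ r0 rr1 _ bad2 _ bp0 bad2_scale step2 v vN.
rewrite mulrC -ler_pdivlMr// => h.
rewrite (_ : bad_in_patch _ _ _ _ _ _ = bad_in_patch eps k (nondecaying A k l)
   (fun u => bad2 (step A k u)) v r); last first.
  apply/setP => w; rewrite !inE; congr (`[< _ >]).
  by apply: eq_exists => u; rewrite /bad2 /bad1 iterSr.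
apply: le_trans h _; rewrite /b le_eqVlt; apply/orP; left; apply/eqP.
have -> : (contraction R ^+ 2) ^+ j.+1 * r =
    (contraction R ^+ 2) ^+ j * (contraction R * (contraction R * r)).
  by rewrite exprSr expr2 -!mulrA.
move: ((_ + _) ^+ d) => Y.
by rewrite [in RHS]exprSr; field; rewrite gt_eqF.
Qed.

Lemma grid_cover r : 0 < r -> exists G : nat,
  forall z : I -> R, moment k z = 1 -> exists g : {ffun I -> 'I_G.+1},
    let v i := (g i : nat)%:R * 2 / G%:R - 1 in
    `|moment k v - 1| <= eta /\ local_form eps k v (fun i => z i - v i) <= r ^+ 2.
Proof.
move=> r0.
pose rates : seq R := [:: 1; #|I|%:R * (k.*2.+2%:R * 1 ^+ k.*2.+2);
   #|I|%:R * (k.*2.+1%:R + 1)].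
pose margins : seq R := [:: 1; r ^+ 2; eta].
have margins_gt0 y : y \in margins -> 0 < y.
  by rewrite !inE => /or3P[] /eqP->; rewrite ?exprn_gt0.
have [h0 h00 small] := small_radius rates margins_gt0.
pose G := (Num.truncn (2 / h0)).+1.
have G0 : 0 < G%:R :> R by rewrite ltr0n.
have hG : 2 / G%:R <= h0.
  by rewrite ler_pdivrMr// mulrC -ler_pdivrMr// ltW// truncnS_gt.
have hG0 : 0 < 2 / G%:R :> R by rewrite divr_gt0.
have {small} small := small _ hG0 hG.
exists G => z zN.
have z1 i : `|z i| <= 1.
  rewrite leNgt; apply/negP => zi.
  have := le_moment k z i; rewrite zN => h.
  have : 1 < `|z i| ^+ k.*2.+2 by rewrite exprn_egt1.
  rewrite -normrX ger0_norm; last by rewrite -doubleS pow_even_ge0.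
  by rewrite ltNge h.
pose x i := (z i + 1) * G%:R / 2.
have x0 i : 0 <= x i.
  have := z1 i; rewrite ler_norml => /andP[? _].
  by rewrite divr_ge0// mulr_ge0//; lra.
have xG i : (Num.truncn (x i) < G.+1)%N.
  rewrite ltnS -(@ler_nat R); have /andP[h _] := truncn_itv (x0 i).
  apply: le_trans h _; rewrite /x ler_pdivrMr// mulrC ler_pM2l//.
  by have := z1 i; rewrite ler_norml => /andP[_]; lra.
exists [ffun i => Ordinal (xG i)] => v.
have zv i : `|z i - v i| <= 2 / G%:R.
  have /andP[h1 h2] := truncn_itv (x0 i).
  have -> : z i - v i = (x i - (Num.truncn (x i))%:R) * (2 / G%:R).
    by rewrite /v /x ffunE/=; field; rewrite gt_eqF.
  rewrite normrM (gtr0_norm hG0) ler_piMl// ?(ltW hG0)//.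
  by rewrite ger0_norm ?subr_ge0// lerBlDl ltW// natr1.
have v1 i : `|v i| <= 1.
  have g0 : 0 <= ([ffun i => Ordinal (xG i)] i : nat)%:R * 2 / G%:R :> R.
    by rewrite divr_ge0// mulr_ge0.
  have gG : ([ffun i => Ordinal (xG i)] i : nat)%:R * 2 / G%:R <= 2 :> R.
    rewrite ler_pdivrMr// mulrC ler_pM2l// ler_nat -ltnS.
    exact: ltn_ord.
  by rewrite /v ler_norml; apply/andP; split; lra.
split.
  rewrite -zN distrC; apply: le_trans (lipschitz_moment k (lexx 1) z1 v1 zv) _.
  by apply: small; rewrite !inE eqxx ?orbT.
apply: (@le_trans _ _ (#|I|%:R * (k.*2.+1%:R + 1) * (2 / G%:R))); last first.
  by apply: small; rewrite !inE eqxx ?orbT.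
rewrite -mulrA mulr_natl -sumr_const; apply: ler_sum => i _.
have h1 : 2 / G%:R <= 1 :> R.
  by rewrite -[leLHS]mul1r; apply: small; rewrite !inE eqxx ?orbT.
apply: ler_pM; rewrite ?sqr_ge0//.
- by rewrite addr_ge0 ?mulr_ge0 ?pow_even_ge0// ltW.
- rewrite /local_weight; apply: lerD => //; rewrite ler_piMr//.
  have <- : `|v i| ^+ k.*2 = v i ^+ k.*2.
    by rewrite -normrX ger0_norm// pow_even_ge0.
  by rewrite exprn_ile1.
- rewrite -real_normK ?num_real// expr2 -[leRHS]mulr1.
  by apply: ler_pM => //; exact: le_trans h1.
Qed.

End Iteration.

(** * Separating functionals *)

Section Separation.
Variable R : realType.
Implicit Types (I J : finType) (k l d : nat).

Lemma geometric_small (M x : R) : 0 <= x -> x < 1 -> exists j, M * x ^+ j < 1.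
Proof.
move=> x0 x1.
have M0 : 0 < `|M| + 1 by have := normr_ge0 M; lra.
have xn : `|x| < 1 by rewrite ger0_norm.
have /cvgrPdist_lt /(_ (`|M| + 1)^-1) := cvg_expr xn.
rewrite invr_gt0 => /(_ M0) [j _ /(_ j (leqnn j))] /=.
rewrite sub0r normrN normrX (ger0_norm x0) => xj; exists j.
have xj0 : 0 <= x ^+ j by rewrite exprn_ge0.
apply: le_lt_trans (_ : (`|M| + 1) * x ^+ j < _).
  by rewrite ler_wpM2r//; have := ler_norm M; lra.
by rewrite mulrC -ltr_pdivlMr// div1r.
Qed.

(** Otherwise, whatever q and j are, every w is bad in some patch of a fixed
    grid: nondecaying points may be rescaled to be normalized. The number of
    patches does not depend on q and j, whereas by iterated_count the fraction
    of the w bad in a given patch tends to 0. *)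
Lemma nonvanishing_functionals I J (A : J -> I -> R) k l d :
  (forall j i, `|A j i| <= 1) ->
  #|I|%:R <= expR 1 ^+ k.+1 :> R -> #|J|%:R <= expR 1 ^+ l.+1 :> R ->
  contraction R ^+ d < cover_prob R k l ->
  exists q j (w : {ffun 'I_d -> {ffun I -> 'I_q.+1}}), forall z,
    nondecaying A k l z -> 0 < moment k z ->
    ~ vanish (iter j (round_trip A k l) z) w.
Proof.
move=> A1 cI cJ sp.
have s0 := contraction_gt0 R; have p0 := cover_prob_gt0 R k l.
have pos_seq (b : seq R) : b = [:: 1; 1 / 1000] -> forall y, y \in b -> 0 < y.
  by move=> -> y; rewrite !inE => /orP[] /eqP->; lra.
(* eps and eta only have to satisfy finitely many linear bounds. *)
have [eps eps0 /(_ _ eps0 (lexx _)) epsP] :=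
  small_radius [:: 1; 2 * #|I|%:R; 2 * #|J|%:R] (pos_seq _ erefl).
have [eta eta0 /(_ _ eta0 (lexx _)) etaP] :=
  small_radius [:: 2 * (k.*2.+1 * l.+1)%:R; 2 * (l.*2.+1 * k.+1)%:R : R]
    (pos_seq _ erefl).
have eps1 : eps <= 1 by rewrite -[eps]mul1r; apply: epsP; rewrite !inE eqxx.
have hI : 2 * eps * #|I|%:R <= 1 / 1000.
  by rewrite mulrAC; apply: epsP; rewrite !inE eqxx ?orbT.
have hJ : 2 * eps * #|J|%:R <= 1 / 1000.
  by rewrite mulrAC; apply: epsP; rewrite !inE eqxx ?orbT.
have hkl : 2 * eta * (k.*2.+1 * l.+1)%:R <= 1 / 1000.
  by rewrite mulrAC; apply: etaP; rewrite !inE eqxx ?orbT.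
have hlk : 2 * eta * (l.*2.+1 * k.+1)%:R <= 1 / 1000.
  by rewrite mulrAC; apply: etaP; rewrite !inE eqxx ?orbT.
have [r r0 count] := iterated_count A1 eps0 eps1 eta0 cI cJ hkl hlk hI hJ d.
have [G grid] := @grid_cover R I k eps eta eps0 eps1 eta0 r r0.
set C := 4 * #|I|%:R ^+ 2 / eps in count.
have C0 : 0 <= C.
  apply: divr_ge0; last exact: ltW.
  by apply: mulr_ge0 => //; exact: sqr_ge0.
pose C' := C * r + 1.
have C'1 : 1 <= C' by rewrite /C' lerDr mulr_ge0// ltW.
pose K0 : R := #|{: {ffun I -> 'I_G.+1}}|%:R.
(* Ratio by which one round trip multiplies the fraction of bad
   functionals. *)
pose x := (contraction R ^+ d / cover_prob R k l) ^+ 2.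
have sd0 : 0 <= contraction R ^+ d by rewrite exprn_ge0// ltW.
have x0 : 0 <= x by exact: sqr_ge0.
have x1 : x < 1.
  by rewrite /x exprn_ilt1// ?divr_ge0 ?(ltW p0)// ltr_pdivrMr// mul1r.
have [j Kj] := geometric_small (K0 * (2 * C') ^+ d) x0 x1.
pose y := (contraction R ^+ 2) ^+ j.
have y0 : 0 < y by rewrite !exprn_gt0.
(* The integer grid of functionals must be finer than the final radius. *)
have [q qy] : exists q : nat, q.+1%:R^-1 <= C' * y.
  exists (Num.truncn (C' * y)^-1).
  rewrite invf_ple ?posrE ?ltr0n//; last by rewrite mulr_gt0//; lra.
  by rewrite ltW// truncnS_gt.
exists q, j; apply: contrapT => no.
have {no} bad (w : {ffun 'I_d -> {ffun I -> 'I_q.+1}}) : exists z,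
    [/\ nondecaying A k l z, 0 < moment k z &
        vanish (iter j (round_trip A k l) z) w].
  apply: contrapT => nz; apply: no; exists w => z gz mz vz.
  by apply: nz; exists z.
pose N := #|{: {ffun 'I_d -> {ffun I -> 'I_q.+1}}}|.
have N0 : (0 < N)%N by rewrite /N !card_ffun !card_ord !expn_gt0.
pose v (g : {ffun I -> 'I_G.+1}) i : R := (g i : nat)%:R * 2 / G%:R - 1.
pose close g := `|moment k (v g) - 1| <= eta.
pose P g := bad_in_patch eps k (nondecaying A k l)
  (fun u (w : {ffun 'I_d -> {ffun I -> 'I_q.+1}}) =>
      vanish (iter j (round_trip A k l) u) w) (v g) r.
have : N%:R <= \sum_(g | close g) #|P g|%:R :> R.
  rewrite -natr_sum ler_nat /N -sum1_card.
  apply: leq_trans (_ : \sum_w \sum_(g | close g) (w \in P g) <= _)%N.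
    apply: leq_sum => w _; have [z [gz mz vz]] := bad w.
    have [c c0 cz] := inverse_root k.*2.+1 mz.
    have [|g [gN gz']] := grid (fun i => c * z i); first by rewrite moment_scale.
    rewrite (bigD1 g)//= (_ : w \in P g) ?leq_addr//.
    rewrite inE; apply/asboolP.
    exists (fun i => c * z i); split => //; first exact: nondecaying_scale.
    exact: vanish_scale.
  rewrite exchange_big/=; apply: leq_sum => g _.
  rewrite -sum1_card [leqRHS]big_mkcond/=; apply: leq_sum => w _.
  by case: (w \in P g).
apply/negP; rewrite -ltNge.
pose b : R := (cover_prob R k l ^- 2) ^+ j * ((2 * C' * y) ^+ d * N%:R).
apply: le_lt_trans (_ : \sum_(g : {ffun I -> 'I_G.+1}) b < _).
  rewrite [leLHS]big_mkcond/=; apply: ler_sum => g _.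
  have pj : 0 <= (cover_prob R k l ^- 2) ^+ j.
    by rewrite exprn_ge0// invr_ge0 exprn_ge0// ltW.
  case: ifPn => [gN|_]; last first.
    by rewrite mulr_ge0// mulr_ge0// exprn_ge0// mulr_ge0 ?(ltW y0)//; lra.
  apply: le_trans (count j q r (v g) r0 (lexx _) gN) _.
  rewrite -/y /b ler_wpM2l// ler_wpM2r//.
  have Cy : 0 <= C * (y * r) by rewrite mulr_ge0// mulr_ge0 ?ltW.
  have q0 : 0 <= q.+1%:R^-1 :> R by rewrite invr_ge0.
  have CC : C * (y * r) <= C' * y.
    by rewrite /C' mulrDl mul1r [y * r]mulrC mulrA lerDl ltW.
  have Cq : C * (y * r) + q.+1%:R^-1 <= 2 * C' * y.
    have -> : 2 * C' * y = C' * y + C' * y by ring.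
    exact: lerD.
  have Cq0 : 0 <= C * (y * r) + q.+1%:R^-1 by exact: addr_ge0.
  by rewrite lerXn2r ?nnegrE// (le_trans Cq0).
rewrite sumr_const -[ltLHS]mulr_natl -/K0.
have -> : K0 * b = K0 * (2 * C') ^+ d * x ^+ j * N%:R.
  rewrite /b [(_ * y) ^+ d]exprMn.
  have -> : y ^+ d = (contraction R ^+ d) ^+ 2 ^+ j.
    by rewrite /y -!exprM; congr (_ ^+ _); ring.
  have -> : x ^+ j = (contraction R ^+ d) ^+ 2 ^+ j * cover_prob R k l ^- 2 ^+ j.
    by rewrite /x [(_ / _) ^+ 2]expr_div_n [LHS]exprMn.
  by ring.
by rewrite gtr_pMl ?ltr0n.
Qed.

End Separation.

(** * The dimension *)

Section Budget.
Variable R : realType.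

Lemma ln2_ge : 2 / 3 <= ln 2 :> R.
Proof.
have e8 : expR 1 ^+ 2 <= 8 :> R.
  have := expR1_le R; have := expR_gt0 (1 : R); move: (expR 1) => e; nra.
rewrite -ler_expR lnK ?posrE// -(@ler_pXn2r _ 3)// ?nnegrE ?expR_ge0//.
rewrite -expRM_natl (_ : 3%:R * (2 / 3) = 2%:R * 1) ?expRM_natl; last by field.
by apply: le_trans e8 _; lra.
Qed.

Definition log_floor n := Num.truncn (ln n%:R : R).

Lemma log_floorP n : (0 < n)%N ->
  n%:R <= expR 1 ^+ (log_floor n).+1 :> R /\
  (log_floor n).*2.+1%:R <= 2 * ln (2 * n)%:R - 1 / 3 :> R.
Proof.
move=> n0; have n1 : 1 <= n%:R :> R by rewrite ler1n.
have np : 0 < n%:R :> R by rewrite ltr0n.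
have /andP[h1 h2] := truncn_itv (ln_ge0 n1); split.
  by rewrite -expRM_natl mulr1 -[leLHS](lnK _) ?posrE// ler_expR ltW.
rewrite natrM lnM ?posrE// -natr1 -muln2 natrM -/(log_floor n).
have := ln2_ge; rewrite -/(log_floor n) in h1; lra.
Qed.

(** With x = 2 log_floor M + 1 <= 2 log(2M) - 1/3, and y likewise, the product
    4 log(2M) log(2N) exceeds x y by 7/9 or more, as log 2 >= 2/3. After
    multiplication by e^2 >= 5.9 the gap is at least 4, hence d/2 >= 3t + 12,
    and e^12 > 51^2. *)
Lemma contraction_lt_cover_prob (M N : nat) (d : nat) : (0 < M)%N -> (0 < N)%N ->
  24%:R * expR 1 ^+ 2 * ln (2 * N)%:R * ln (2 * M)%:R < d%:R :> R ->
  contraction R ^+ d < cover_prob R (log_floor M) (log_floor N).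
Proof.
move=> M0 N0; rewrite /contraction.
have [_ kM] := log_floorP M0; have [_ lN] := log_floorP N0.
have a0 : 2 / 3 <= ln (2 * M)%:R :> R.
  apply: le_trans ln2_ge _; rewrite ler_ln ?posrE ?ltr0n ?muln_gt0//.
  by rewrite ler_nat leq_pmulr.
have b0 : 2 / 3 <= ln (2 * N)%:R :> R.
  apply: le_trans ln2_ge _; rewrite ler_ln ?posrE ?ltr0n ?muln_gt0//.
  by rewrite ler_nat leq_pmulr.
rewrite /cover_prob /trace_bound.
have x1 : 0 <= (log_floor M).*2.+1%:R :> R by [].
have y1 : 0 <= (log_floor N).*2.+1%:R :> R by [].
move: (ln (2 * M)%:R) (ln (2 * N)%:R) a0 b0 kM lN x1 y1 => a b a0 b0.
move: ((log_floor M).*2.+1%:R) ((log_floor N).*2.+1%:R) => x y kM lN x0 y0 hd.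
have e1 := expR1_ge R; set e := expR 1 in hd e1 *.
have e2 : 59 / 10 <= e ^+ 2 by nra.
have xy : x * y <= (2 * a - 1 / 3) * (2 * b - 1 / 3) by apply: ler_pM.
have gap : 7 / 9 <= 4 * (a * b) - x * y by nra.
have gape : 4 <= e ^+ 2 * (4 * (a * b) - x * y).
  apply: le_trans (_ : 59 / 10 * (7 / 9) <= _); first lra.
  by apply: ler_pM => //; lra.
apply: lt_le_trans (_ : expR (- (3 * (x * y * e ^+ 2)) - 12) <= _).
  rewrite -expRM_natl ltr_expR; lra.
rewrite expRD ler_pM2l ?expR_gt0// expRN lef_pV2 ?posrE ?expR_gt0 ?exprn_gt0//.
have -> : 12 = 12%:R * 1 :> R by rewrite mulr1.
rewrite expRM_natl -/e.
have e0 : 0 <= e by lra.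
have e4 : 34 <= (e ^+ 2) ^+ 2 by nra.
have : 34 * (34 * 34) <= (e ^+ 2) ^+ 2 * ((e ^+ 2) ^+ 2 * (e ^+ 2) ^+ 2).
  by apply: ler_pM; rewrite ?mulr_ge0//; apply: ler_pM.
rewrite -!exprM -!exprD; apply: le_trans; lra.
Qed.

End Budget.

(** * Continuity *)

Section Topology.
Variable R : realType.

Lemma continuous_lincomb (T : topologicalType) (I : finType) (c : I -> R)
    (u : T -> I -> R) : (forall i, continuous (fun y => u y i)) ->
  continuous (fun y => \sum_i c i * u y i).
Proof.
move=> uc x; apply: cvg_big => [|i _]; first exact: add_continuous.
by apply: cvgM; [exact: cvg_cst|exact: uc].
Qed.

Lemma continuousB_fun (T : topologicalType) (f g : T -> R) :
  continuous f -> continuous g -> continuous (fun y => f y - g y).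
Proof. by move=> fc gc x; apply: cvgB; [exact: fc|exact: gc]. Qed.

Lemma continuous_step (T : topologicalType) (I J : finType) (A : J -> I -> R) k
    (u : T -> I -> R) : (forall i, continuous (fun y => u y i)) ->
  forall j, continuous (fun y => step A k (u y) j).
Proof.
move=> uc j; apply: continuous_lincomb => i x.
exact: (cvg_comp _ _ (uc i x) (@exprn_continuous R _ (u x i))).
Qed.

Lemma continuous_iter_round_trip (T : topologicalType) (I J : finType)
    (A : J -> I -> R) k l n (u : T -> I -> R) :
  (forall i, continuous (fun y => u y i)) ->
  forall i, continuous (fun y => iter n (round_trip A k l) (u y) i).
Proof.
move=> uc; elim: n => [|n IHn]; first exact: uc.
by apply: continuous_step; exact: continuous_step.
Qed.

Lemma continuous_sqr_norm (T : topologicalType) (I : finType) (u : T -> I -> R) :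
  (forall i, continuous (fun y => u y i)) ->
  continuous (fun y => \sum_i u y i ^+ 2).
Proof.
move=> uc x; apply: cvg_big => [|i _]; first exact: add_continuous.
exact: (cvg_comp _ _ (uc i x) (@exprn_continuous R _ (u x i))).
Qed.

Lemma continuous_div_sqrt (T : topologicalType) (f g : T -> R) x :
  continuous f -> continuous g -> 0 < g x ->
  {for x, continuous (fun y => f y / Num.sqrt (g y))}.
Proof.
move=> fc gc gx; apply: cvgM; first exact: fc.
apply: cvgV; first by rewrite sqrtr_eq0 -ltNge.
exact: (cvg_comp _ _ (gc x) (@sqrt_continuous R (g x))).
Qed.

Lemma continuous_row (T : topologicalType) d (f : T -> 'I_d -> R) x :
  (forall t, {for x, continuous (fun y => f y t)}) ->
  {for x, continuous (fun y => \row_t f y t : 'rV[R]_d)}.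
Proof.
move=> fc; apply/cvg_mx_entourageP => E entE.
apply: filter_forall => i; apply: filter_forall => t.
have /cvg_entourageP /(_ E entE) fE := fc t.
move: fE; rewrite !near_map; apply: filterS => y Ey.
by rewrite /= !mxE; apply: mem_set.
Qed.

End Topology.

(** * The map on the sign complex *)

Section SignComplexMap.
Variable R : realType.
Variables (M N : nat) (A : partial_sign_matrix M N).

Definition sign_value (a : option bool) : R :=
  if a is Some b then sign_of R b else 0.

Definition numeric (j : 'I_N) (i : 'I_M) : R := sign_value (A i j).

Lemma abs_numeric j i : `|numeric j i| <= 1.
Proof.
by rewrite /numeric; case: (A i j) => [[]|] /=; rewrite ?normrN ?normr1 ?normr0.
Qed.

Definition signed_mass (x : {ptws signed_column N -> R}) (j : 'I_N) : R :=
  x (j, true) - x (j, false).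

Definition row_values (x : {ptws signed_column N -> R}) (i : 'I_M) : R :=
  \sum_j numeric j i * signed_mass x j.

(** On sigma_r^+ each term of row r has the sign of its entry, so nothing
    cancels in that row. *)
Lemma row_values_normalized x : realization R (sign_complex A) x ->
  \sum_j `|signed_mass x j| <= 1 /\ exists i, `|row_values x i| = 1.
Proof.
move=> [x0 x1 xK].
have sumE : \sum_j (x (j, true) + x (j, false)) = 1.
  rewrite -x1; transitivity (\sum_j \sum_b x (j, b)).
    by apply: eq_bigr => j _; rewrite big_bool.
  by rewrite pair_bigA/=; apply: eq_bigr => -[].
split.
  rewrite -sumE; apply: ler_sum => j _; apply: le_trans (ler_normB _ _) _.
  by rewrite !ger0_norm.
move: xK; rewrite inE => /existsP[i /orP[] /fintype.subsetP supp]; exists i.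
- rewrite (_ : row_values x i = 1) ?normr1// -sumE; apply: eq_bigr => j _.
  rewrite /numeric /signed_mass.
  have := supp (j, true); have := supp (j, false); rewrite !inE/=.
  have [->|_] := eqVneq (x (j, true)) 0; have [->|_] := eqVneq (x (j, false)) 0.
  + by move=> _ _; rewrite subrr mulr0 addr0.
  + by move=> /(_ isT) /eqP-> _; rewrite /= /sign_of; ring.
  + by move=> _ /(_ isT) /eqP->; rewrite /= /sign_of; ring.
  + by move=> /(_ isT) /eqP-> /(_ isT) /eqP.
- rewrite (_ : row_values x i = - 1) ?normrN ?normr1// -sumE -sumrN.
  apply: eq_bigr => j _; rewrite /numeric /signed_mass.
  have := supp (j, true); have := supp (j, false).
  rewrite !sigma_negE !inE/=.
  have [->|_] := eqVneq (x (j, true)) 0; have [->|_] := eqVneq (x (j, false)) 0.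
  + by move=> _ _; rewrite subrr mulr0 addr0 oppr0.
  + by move=> /(_ isT) /eqP-> _; rewrite /= /sign_of; ring.
  + by move=> _ /(_ isT) /eqP->; rewrite /= /sign_of; ring.
  + by move=> /(_ isT) /eqP-> /(_ isT) /eqP.
Qed.

Lemma continuous_row_values i : continuous (fun x => row_values x i).
Proof.
pose T : topologicalType := {ptws signed_column N -> R}.
have pc v : continuous (fun x : T => (x : _ -> R) v).
  exact: (@proj_continuous _ (fun=> R : topologicalType) v).
have sc j : continuous (fun x : T => signed_mass x j).
  exact: (continuousB_fun (pc (j, true)) (pc (j, false))).
exact: (@continuous_lincomb R T _ (numeric^~ i) (fun x j => signed_mass x j) sc).
Qed.

Lemma row_values_swap x : row_values (swap_coords x) = (fun i => - row_values x i).
Proof.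
apply/funext => i; rewrite -sumrN; apply: eq_bigr => j _.
by rewrite /signed_mass /swap_coords /= /flip/=; ring.
Qed.

Lemma step_opp (I J : finType) (B : J -> I -> R) k (u : I -> R) :
  step B k (fun i => - u i) = (fun j => - step B k u j).
Proof.
apply/funext => j; rewrite /step -sumrN; apply: eq_bigr => i _.
by rewrite exprNn -signr_odd /= odd_double/= expr1 mulN1r mulrN.
Qed.

Lemma iter_round_trip_opp (I J : finType) (B : J -> I -> R) k l n (u : I -> R) :
  iter n (round_trip B k l) (fun i => - u i) =
  (fun i => - iter n (round_trip B k l) u i).
Proof.
by elim: n => // n IHn; rewrite !iterS IHn /round_trip !step_opp.
Qed.

(** Every ingredient is odd: signed_mass, the steps with their odd powers,
    and the linear functionals. *)
Lemma sign_complex_to_sphere d : (0 < M)%N -> (0 < N)%N ->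
  24%:R * expR 1 ^+ 2 * ln (2 * N)%:R * ln (2 * M)%:R < d.+1%:R :> R ->
  exists f, @equivariant_map (realized_sign_complex A R) (sphere R d) f.
Proof.
move=> M0 N0 hd.
set k := log_floor R M; set l := log_floor R N.
have [cI _] := log_floorP R M0; have [cJ _] := log_floorP R N0.
rewrite -[in M%:R](card_ord M) in cI; rewrite -[in N%:R](card_ord N) in cJ.
have [q [n [w nonzero]]] :=
  nonvanishing_functionals abs_numeric cI cJ (contraction_lt_cover_prob M0 N0 hd).
pose h x (t : 'I_d.+1) : R :=
  \sum_i (w t i : nat)%:R * iter n (round_trip numeric k l) (row_values x) i.
have hN x t : h (swap_coords x) t = - h x t.
  rewrite /h row_values_swap iter_round_trip_opp -sumrN.
  by apply: eq_bigr => i _; rewrite mulrN.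
have hc t : continuous (fun x : {ptws signed_column N -> R} => h x t).
  apply: (@continuous_lincomb R {ptws signed_column N -> R}) => i.
  apply: (@continuous_iter_round_trip R {ptws signed_column N -> R}).
  exact: continuous_row_values.
pose nr x := \sum_t h x t ^+ 2.
have nr0 x : realization R (sign_complex A) x -> 0 < nr x.
  move=> /row_values_normalized[y1 z1].
  have [gz mz] := @nondecaying_start R _ _ numeric k l (signed_mass x) y1 z1.
  have nz := nonzero _ gz (lt_le_trans ltr01 mz).
  rewrite lt_neqAle eq_sym sumr_ge0 ?andbT => [|t _]; last exact: sqr_ge0.
  apply/eqP => nr0; apply: nz => t.
  have /eqP := nr0; rewrite psumr_eq0 => [|t' _]; last exact: sqr_ge0.
  by move=> /allP /(_ t (mem_index_enum t)) /=; rewrite sqrf_eq0 => /eqP.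
have nrc : continuous (nr : {ptws signed_column N -> R} -> R).
  exact: (@continuous_sqr_norm R {ptws signed_column N -> R} _ h hc).
exists (fun x => \row_t (h x t / Num.sqrt (nr x))); split.
- apply: continuous_in_subspaceT => x; rewrite inE => xK.
  apply: continuous_row => t.
  exact: (@continuous_div_sqrt R {ptws signed_column N -> R} _ _ x
           (hc t) nrc (nr0 x xK)).
- move=> x xK; rewrite /= /sphere_set /=.
  under eq_bigr do rewrite mxE expr_div_n sqr_sqrtr ?(ltW (nr0 x xK))//.
  by rewrite -mulr_suml divff// gt_eqF// nr0.
- move=> x xK; apply/rowP => t; rewrite !mxE /=.
  have -> : nr (swap_coords x) = nr x.
    by apply: eq_bigr => t' _; rewrite hN sqrrN.
  by rewrite hN mulNr.
Qed.

End SignComplexMap.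

Lemma ind_le (R : realType) (X : free_z2space) d :
  (exists f, @equivariant_map X (sphere R d) f) -> (ind R X <= d%:R%:E)%E.
Proof.
move=> fX; rewrite /ind; case: pselect => [X0|X0].
  by rewrite lee_fin (le_trans (_ : -1 <= 0)) ?lerN10.
case: pselect => [e|]; last by case; exists d; apply/asboolP.
rewrite lee_fin ler_nat; case: ex_minnP => m _; apply; exact/asboolP.
Qed.

Lemma ind_sign_complex (R : realType) (M N : nat) (A : partial_sign_matrix M N) :
  (0 < M)%N -> (0 < N)%N ->
  (ind R (realized_sign_complex A R)
     <= (24%:R * expR 1 ^+ 2 * ln (2 * N)%:R * ln (2 * M)%:R)%:E)%E.
Proof.
move=> M0 N0; set b := _ * ln (2 * M)%:R.
have ln0 n : (0 < n)%N -> 0 <= ln (2 * n)%:R :> R.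
  by move=> n0; rewrite ln_ge0// ler1n muln_gt0.
have b0 : 0 <= b by rewrite !mulr_ge0 ?ln0// sqr_ge0.
have := truncnS_gt b => /(sign_complex_to_sphere A M0 N0) /ind_le /le_trans; apply.
by rewrite lee_fin; have /andP[] := truncn_itv b0.
Qed.

Theorem corollary12 (R : realType) :
  let C0 : R := 24%:R * expR 1 ^+ 2 in
  (forall (M N : nat) (A : partial_sign_matrix M N),
     (0 < M)%N -> (0 < N)%N ->
     (ind R (realized_sign_complex A R)
        <= (C0 * ln (2 * N)%:R * ln (2 * M)%:R)%:E)%E) /\
  (forall (N : nat) (A : partial_sign_matrix N N),
     (0 < N)%N ->
     (ind R (realized_sign_complex A R)
        <= (C0 * ln (2 * N)%:R ^+ 2)%:E)%E).
Proof.
split=> [M N A M0 N0|N A N0]; first exact: ind_sign_complex.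
by have := ind_sign_complex R A N0 N0; rewrite -mulrA -expr2.
Qed.
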